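(* Let $A$ be an operator algebra (equipped with a triple $(A,\Delta(A),\varphi_A)$). Then the following are completely isometric isomorphism invariants for $A$: (1) The graph $G(A)=(V(A),E(A),r,s)$. (2) Edge freeness of $A$. (3) Admissible paths in the graph $G(A)$ when $A$ is edge free. (4) The weak-$*$ topology on $V(A)$. (5) The partially ordered set of topological partitions of $E(A)$. (6) The partially ordered set of coloring functions for a fixed topological partition of $E(A)$ (with $A$ edge free and the partition indexed by a countable set). (7) The collection of edge-colored topological graphs compatible with $G(A)$ when $A$ is edge free.
   Context: An operator algebra means an abstract operator algebra (a subalgebra of some $B(H)$). $\Delta(A)=A\cap A^*$ is the diagonal, the largest $C^*$-subalgebra of $A$. $V(A)$ is the set of (nonzero) multiplicative linear functionals on $\Delta(A)$, with the weak-$*$ topology. A triple $(A,\Delta(A),\varphi_A)$ consists of an operator algebra $A$, its diagonal, and a completely contractive map $\varphi_A:A\to\Delta(A)$ which is the identity on $\Delta(A)$. Triples $(A,\Delta(A),\varphi_A)$ and $(B,\Delta(B),\varphi_B)$ are called completely isometrically isomorphic via $\pi$ if there is a completely isometric isomorphism $\pi:A\to B$. For $v\in V(A)$ write $\pi(v)=v\circ\pi^{-1}\in V(B)$. Invariance. That an item is a completely isometric isomorphism invariant means: whenever $(A,\Delta(A),\varphi_A)$ and $(B,\Delta(B),\varphi_B)$ are completely isometrically isomorphic via $\pi$, the item for $A$ and the item for $B$ (defined in the same way from $B$'s triple) are equivalent, i.e. correspond under $\pi$: vertices by the map $v\mapsto\pi(v)$ (a homeomorphism in (4)), edges by a bijection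 $e\mapsto\pi(e)$ of $E(A)$ onto $E(B)$ taking edges from $v$ to $w$ to edges from $\pi(v)$ to $\pi(w)$ and coming from vector space isomorphisms of $E_{w,v}$ with $E_{\pi(w),\pi(v)}$ (defined below), paths by $e_n\cdots e_1\mapsto\pi(e_n)\cdots\pi(e_1)$, and partitions and colorings accordingly, with orderings preserved in (5) and (6). In (6) a fixed topological partition of $E(A)$ is compared with the corresponding topological partition of $E(B)$. Edges. $T_n$ is the algebra of upper triangular $n\times n$ complex matrices; representations are homomorphisms. For $v,w\in V(A)$ let $T_{w,v}$ be the collection of completely contractive representations $T:A\to T_2$ of the form $T(a)=\begin{bmatrix} w(\varphi_A(a)) & t(a)\\ 0& v(\varphi_A(a))\end{bmatrix}$ with $t$ a nonzero linear map. Let $K_{w,v}=\bigcap\{\ker T:T\in T_{w,v}\}$ (equal to $A$ if $T_{w,v}$ is empty) and $E_{w,v}=\ker\varphi_A/(K_{w,v}\cap\ker\varphi_A)$. Fix a basis of each $E_{w,v}$; each basis element $e$ is an edge with source $s(e)=v$ and range $r(e)=w$. $E(A)$ is the union of all these edges over all pairs $(v,w)$. Edge freeness. Let $q:A\to E_{w,v}$ be the map that is zero on $\Delta(A)$ and the canonical quotient on $\ker\varphi_A$. Given a basis $\{e_\lambda\}$ of $E_{w,v}$, let $t_\lambda:E_{w,v}\to\mathbb C$ be linear with $t_\lambda(e_\mu)=1$ if $\mu=\lambda$ and $0$ otherwise, and let $T_\lambda(a)=\begin{bmatrix} w(\varphi_A(a)) & t_\lambda(q(a))\\ 0& v(\varphi_A(a))\end{bmatrix}$.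 $A$ is $v$-$w$ free if there is a choice of basis of $E_{w,v}$ such that all the $T_\lambda$ are completely contractive homomorphisms; $A$ is edge free if it is $v$-$w$ free for every pair $v,w\in V(A)$. When an algebra is edge free, a basis of each $E_{w,v}$ with this property is fixed and used to define the edges; for an edge $e=e_\lambda$ write $t_e(a)=t_\lambda(q(a))$. Admissible paths. For $A$ edge free, a path $e_ne_{n-1}\cdots e_1$ in $G(A)$ (with $s(e_{i+1})=r(e_i)$) is admissible for $A$ if there is a completely contractive representation $A\to T_{n+1}$ whose value at $a$ has diagonal entries $r(e_n)(\varphi_A(a)),r(e_{n-1})(\varphi_A(a)),\dots,r(e_1)(\varphi_A(a)),s(e_1)(\varphi_A(a))$ in this order, first superdiagonal entries $t_{e_n}(a),t_{e_{n-1}}(a),\dots,t_{e_1}(a)$ in this order, and potentially nonzero entries above the first superdiagonal. Topological partitions. Consider a partition $E(A)=\bigcup_{\lambda\in\Lambda}E_\lambda$ such that distinct edges in the same component have distinct sources. Let $V_\lambda=\{s(e):e\in E_\lambda\}$, with the topology inherited from $V(A)$, and let $E_\Lambda=\{(\lambda,v):v\in V_\lambda\}\subseteq\Lambda\times V(A)$ with the subspace topology of the product topology ($\Lambda$ discrete). Put $s(\lambda,v)=v$ and $r(\lambda,v)=r(e)$, where $e\in E_\lambda$ and $s(e)=v$. The partition is topological if $(V(A),E_\Lambda,r,s)$ is a topological graph, i.e. $r$ is continuous and proper and $s$ is a local homeomorphism. For topological partitions, $\Lambda_1\le\Lambda_2$ means: whenever $e$ is equivalent to $f$ (in the same component) in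 $\Lambda_2$, then $e$ is equivalent to $f$ in $\Lambda_1$. Colorings. Let $A$ be edge free with a fixed topological partition with $\Lambda$ countable. A coloring function (edge-coloring) is a function $f:\Lambda\to\mathbb N$ such that, for $\lambda_1\neq\lambda_2$, $f(\lambda_1)\neq f(\lambda_2)$ when there exist edges $e_1\in E_{\lambda_1}$ and $e_2\in E_{\lambda_2}$ with $r(e_1)=r(e_2)$ and such that $a\mapsto\begin{bmatrix} r(e_1)(\varphi_A(a)) & t_{e_1}(a)& t_{e_2}(a)\\ 0& s(e_1)(\varphi_A(a))&0\\ 0&0&s(e_2)(\varphi_A(a))\end{bmatrix}$ is a completely contractive representation $A\to T_3$. A coloring function $f$ is less than or equal to $g$ if there exists a permutation $\sigma:\mathbb N\to\mathbb N$ such that $f(n)\le g(\sigma(n))$ for all $n\in\mathbb N$ (the elements of the countable set $\Lambda$ being denoted here by natural numbers $n$). An edge-colored topological graph compatible with $G(A)$ is a topological graph $(V(A),E_\Lambda,r,s)$ arising from a topological partition of $E(A)$ with $\Lambda$ countable, together with a coloring function for it.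
   Formalization: The isomorphism π is also required to satisfy π∘φ_A = φ_B∘π (else (1) fails: disc algebra, φ_A(f)=f(0), φ_B(f)=f(1)), and in (3), (6), (7) the fixed free bases of A and B are taken to correspond under the maps E_{w,v} → E_{π(w),π(v)} induced by π. *)

(* Defs.v *)
From HB Require Import structures.
From mathcomp Require Import all_boot all_order all_algebra.
From mathcomp Require Import complex.
From mathcomp Require Import all_classical all_reals all_analysis.

Set Implicit Arguments.
Unset Strict Implicit.
Unset Printing Implicit Defensive.

Import Order.TTheory GRing.Theory Num.Theory.
Import numFieldNormedType.Exports.

Local Open Scope classical_set_scope.
Local Open Scope ring_scope.
Local Open Scope complex_scope.
Local Open Scope quotient_scope.

Definition hamel_basis (K : fieldType) (V : lmodType K) (b : set V) : Prop :=
  (forall (s : seq V) (c : V -> K), uniq s -> [set` s] `<=` b ->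
     \sum_(x <- s) c x *: x = 0 -> forall x, x \in s -> c x = 0) /\
  (forall x : V, exists (s : seq V) (c : V -> K),
     [set` s] `<=` b /\ x = \sum_(y <- s) c y *: y).

(* The functional dual to [e] in the basis [b]; when [b] is a basis it exists
   and is unique, so that the default value is not used. *)
Definition coord (K : fieldType) (V : lmodType K) (b : set V) (e : V) : V -> K :=
  xget (fun=> 0)
    [set t : V -> K | scalar t /\ forall f, b f -> t f = (f == e)%:R].

Structure hilbert (R : realType) := Hilbert {
  hilbert_sort :> completeNormedModType R[i] ;
  hdot : {dot hilbert_sort for (@Num.conj R[i])} ;
  hdot_norm : forall x : hilbert_sort, `|x| ^+ 2 = hdot x x
}.

Section MatrixNorm.
Variable R : realType.

(* the norm of a normed space over R[i] has values in R[i] *)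
Definition rnorm (V : normedZmodType R[i]) (x : V) : R := complex.Re `|x|.

Definition l2norm (X : Type) (nrm : X -> R) (n : nat) (x : 'I_n -> X) : R :=
  Num.sqrt (\sum_i nrm (x i) ^+ 2).

(* operator norm on the l2 direct sum of n copies of (X, nrm) *)
Definition mxopnorm (X : zmodType) (nrm : X -> R) (n : nat)
    (a : 'M[X -> X]_n) : R :=
  sup [set l2norm nrm (fun i => \sum_j a i j (x j)) |
       x in [set x : 'I_n -> X | l2norm nrm x <= 1]].

(* matrix norms of M_n, acting on the Euclidean space C^n *)
Definition cmxnorm (n k : nat) (a : 'M['M[R[i]]_n]_k) : R :=
  mxopnorm (fun x : 'cV[R[i]]_n => l2norm (@rnorm R[i]) (fun i => x i ord0))
           (map_mx (fun (M : 'M[R[i]]_n) (x : 'cV[R[i]]_n) => M *m x) a).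

End MatrixNorm.

(* A subalgebra of B(H), presented as the injective image of [oa_sort] under
   [oa_rep]; a bounded operator is a continuous linear map. Neither a unit nor
   norm closedness is required. *)
Structure opalg (R : realType) := OpAlg {
  oa_sort :> lmodType R[i] ;
  oa_mul : oa_sort -> oa_sort -> oa_sort ;
  oa_space : hilbert R ;
  oa_rep : oa_sort -> {linear oa_space -> oa_space} ;
  oa_rep_continuous : forall a, continuous (oa_rep a) ;
  oa_rep_linear : forall (c : R[i]) a b x,
    oa_rep (c *: a + b) x = c *: oa_rep a x + oa_rep b x ;
  oa_rep_mul : forall a b x, oa_rep (oa_mul a b) x = oa_rep a (oa_rep b x) ;
  oa_rep_inj : forall a b, oa_rep a =1 oa_rep b -> a = b
}.

Section OperatorAlgebra.
Variables (R : realType) (A : opalg R).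

Definition oa_mxnorm (n : nat) (a : 'M[A]_n) : R :=
  mxopnorm (@rnorm R (oa_space A))
           (map_mx (fun b => oa_rep b : oa_space A -> oa_space A) a).

Definition is_adjoint (a b : A) : Prop :=
  forall x y : oa_space A,
    hdot (oa_space A) (oa_rep a x) y = hdot (oa_space A) x (oa_rep b y).

(* A `&` A^*: the elements of A whose Hilbert space adjoint lies in A *)
Definition diag_pred : {pred A} := fun a => `[< exists b, is_adjoint a b >].

Lemma diag_submod : submod_closed diag_pred.
Proof.
split.
  apply/asboolP; exists 0 => x y.
  have r0 z : oa_rep (0 : A) z = 0.
    have := oa_rep_linear (-1) (0 : A) 0 z.
    by rewrite scaler0 addr0 scaleN1r addNr.
  by rewrite !r0 linear0l linear0r.
move=> c a b /asboolP[a' aa'] /asboolP[b' bb']; apply/asboolP.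
exists (Num.conj c *: a' + b') => x y.
rewrite !oa_rep_linear linearPl linearPr /= aa' bb'.
by rewrite conjCK.
Qed.

HB.instance Definition _ := GRing.isSubmodClosed.Build R[i] A diag_pred
  diag_submod.

Definition diag : Type := {a : A | diag_pred a}.

HB.instance Definition _ := SubChoice.on diag.
HB.instance Definition _ := [SubChoice_isSubLmodule of diag by <:].

Lemma diag_mul_subproof (d d' : diag) : diag_pred (oa_mul (val d) (val d')).
Proof.
case: d d' => [a /= /asboolP[a' aa']] [b /= /asboolP[b' bb']].
by apply/asboolP; exists (oa_mul b' a') => x y; rewrite !oa_rep_mul aa' bb'.
Qed.

Definition diag_mul (d d' : diag) : diag := Sub _ (diag_mul_subproof d d').

Definition cc_rep (n : nat) (T : A -> 'M[R[i]]_n) : Prop :=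
  [/\ linear T,
      forall a b, T (oa_mul a b) = T a *m T b,
      forall a (i j : 'I_n), (j < i)%N -> T a i j = 0 &
      forall k (a : 'M[A]_k), cmxnorm (map_mx T a) <= oa_mxnorm a].

Record character := Character {
  char_fun :> diag -> R[i] ;
  char_scalar : scalar char_fun ;
  char_mul : forall d d', char_fun (diag_mul d d') = char_fun d * char_fun d' ;
  char_neq0 : exists d, char_fun d != 0
}.

HB.instance Definition _ := gen_eqMixin character.
HB.instance Definition _ := gen_choiceMixin character.

(* the weak-* topology, i.e. that of pointwise convergence on the diagonal *)
HB.instance Definition _ := Topological.copy character
  (initial_topology
    (char_fun : character -> {ptws diag -> R[i]^o})).

End OperatorAlgebra.

Structure triple (R : realType) := Triple {
  tr_alg :> opalg R ;
  tr_phi : {linear tr_alg -> diag tr_alg} ;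
  tr_phi_cc : forall n (a : 'M[tr_alg]_n),
    oa_mxnorm (map_mx (fun x => val (tr_phi x)) a) <= oa_mxnorm a ;
  tr_phi_id : forall d : diag tr_alg, tr_phi (val d) = d
}.

Definition seqmx (R : realType) (n : nat) (rows : seq (seq R[i])) : 'M[R[i]]_n :=
  \matrix_(i, j) nth 0 (nth [::] rows i) j.

Section Graph.
Variables (R : realType) (A : triple R).

Definition T_mx (w v : character A) (t : A -> R[i]) (a : A) : 'M[R[i]]_2 :=
  seqmx 2 [:: [:: w (tr_phi A a); t a             ];
              [:: 0             ; v (tr_phi A a)]].

Definition T_set (w v : character A) : set (A -> 'M[R[i]]_2) :=
  [set T | cc_rep T /\ exists t : A -> R[i],
     [/\ scalar t, exists a, t a != 0 & T = T_mx w v t]].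

Definition K_set (w v : character A) : set A :=
  [set a | forall T, T_set w v T -> T a = 0].

Definition kerphi_pred : {pred A} := fun a => tr_phi A a == 0.

Lemma kerphi_submod : submod_closed kerphi_pred.
Proof.
split; first by rewrite /in_mem /= /kerphi_pred linear0.
move=> c a b; rewrite /in_mem /= /kerphi_pred => /eqP a0 /eqP b0.
by rewrite linearP a0 b0 scaler0 addr0.
Qed.

HB.instance Definition _ := GRing.isSubmodClosed.Build R[i] A kerphi_pred
  kerphi_submod.

Definition kerphi : Type := {a : A | kerphi_pred a}.

HB.instance Definition _ := SubChoice.on kerphi.
HB.instance Definition _ := [SubChoice_isSubLmodule of kerphi by <:].

Section EdgeSpace.
Variables w v : character A.

(* K_{w,v} /\ ker phi, inside ker phi *)
Definition Kker_pred : {pred kerphi} := fun x => `[< K_set w v (val x) >].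

Lemma Kker_submod : submod_closed Kker_pred.
Proof.
split; first by apply/asboolP => T [] [lT _ _ _] _; have := lT (-1) 0 0;
  rewrite scaler0 addr0 scaleN1r addNr.
move=> c x y /asboolP Kx /asboolP Ky; apply/asboolP => T TT.
have [[lT _ _ _] _] := TT.
by rewrite /= lT (Kx _ TT) (Ky _ TT) scaler0 addr0.
Qed.

HB.instance Definition _ := GRing.isSubmodClosed.Build R[i] kerphi Kker_pred
  Kker_submod.

Definition edge_space : Type := Quotient.quot Kker_pred.

HB.instance Definition _ := GRing.Zmodule.on edge_space.
HB.instance Definition _ := EqQuotient.on edge_space.

Definition edge_scale (c : R[i]) : edge_space -> edge_space :=
  lift_op1 edge_space ( *:%R c).

Lemma pi_scale (c : R[i]) : {morph \pi_edge_space : x / c *: x >-> edge_scale c x}.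
Proof.
move=> x; unlock edge_scale; apply/eqP.
rewrite -(@Quotient.idealrBE _ Kker_pred) -scalerBr rpredZ //.
by rewrite (@Quotient.idealrBE _ Kker_pred) reprK.
Qed.


Lemma pi_edgeD : {morph \pi_edge_space : x y / x + y}.
Proof. by move=> x y; rewrite (@Quotient.pi_add _ Kker_pred). Qed.

Lemma edge_scaleA (c d : R[i]) (x : edge_space) :
  edge_scale c (edge_scale d x) = edge_scale (c * d) x.
Proof. by rewrite -[x]reprK -!pi_scale scalerA. Qed.

Lemma edge_scale1 : left_id 1 edge_scale.
Proof. by move=> x; rewrite -[x]reprK -pi_scale scale1r. Qed.

Lemma edge_scaleDr : right_distributive edge_scale +%R.
Proof.
move=> c x y; rewrite -[x]reprK -[y]reprK.
by rewrite -pi_edgeD -pi_scale scalerDr pi_edgeD !pi_scale.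
Qed.

Lemma edge_scaleDl (x : edge_space) :
  {morph edge_scale^~ x : c d / c + d}.
Proof.
by move=> c d; rewrite -[x]reprK -!pi_scale scalerDl pi_edgeD.
Qed.

HB.instance Definition _ := GRing.Zmodule_isLmodule.Build R[i] edge_space
  edge_scaleA edge_scale1 edge_scaleDr edge_scaleDl.

Lemma edge_quo_subproof (a : A) : kerphi_pred (a - val (tr_phi A a)).
Proof. by rewrite /kerphi_pred linearB /= tr_phi_id subrr. Qed.

(* The map q. Since a = phi(a) + (a - phi(a)) with a - phi(a) in ker phi, this
   is the map vanishing on the diagonal and equal to the quotient map on
   ker phi. *)
Definition edge_quo (a : A) : edge_space :=
  \pi_edge_space (Sub (a - val (tr_phi A a)) (edge_quo_subproof a) : kerphi).

(* [b] is a basis witnessing that A is v-w free *)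
Definition free_basis (b : set edge_space) : Prop :=
  hamel_basis b /\
  forall e, b e -> cc_rep (T_mx w v (fun a => coord b e (edge_quo a))).

End EdgeSpace.

Definition edge_family : Type := forall w v : character A, set (edge_space w v).

Definition is_basis_choice (b : edge_family) : Prop :=
  forall w v, hamel_basis (b w v).

Definition is_free_choice (b : edge_family) : Prop :=
  forall w v, free_basis (b w v).

Definition edge_free : Prop :=
  forall v w : character A, exists b : set (edge_space w v), free_basis b.

Record edge (b : edge_family) := Edge {
  rng : character A ;
  src : character A ;
  edge_vec : edge_space rng src ;
  edge_mem : b rng src edge_vec
}.

HB.instance Definition _ (b : edge_family) := gen_eqMixin (edge b).
HB.instance Definition _ (b : edge_family) := gen_choiceMixin (edge b).

Definition edge_coef (b : edge_family) (e : edge b) (a : A) : R[i] :=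
  coord (b (rng e) (src e)) (edge_vec e) (edge_quo (rng e) (src e) a).

(* The path written p_0 p_1 ... p_n, which is traversed from p_n to p_0. *)
Definition is_path (b : edge_family) (n : nat) (p : 'I_n.+1 -> edge b) : Prop :=
  forall i j : 'I_n.+1, j = i.+1 :> nat -> src (p i) = rng (p j).

Definition admissible (b : edge_family) (n : nat) (p : 'I_n.+1 -> edge b) : Prop :=
  is_path p /\
  exists T : A -> 'M[R[i]]_n.+2, cc_rep T /\
    forall a,
      [/\ forall i : 'I_n.+1, T a (widen_ord (leqnSn n.+1) i)
                                (widen_ord (leqnSn n.+1) i)
                              = rng (p i) (tr_phi A a),
          T a ord_max ord_max = src (p ord_max) (tr_phi A a) &
          forall i : 'I_n.+1, T a (widen_ord (leqnSn n.+1) i) (lift ord0 i)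
                              = edge_coef (p i) a].

End Graph.

Section Topology.
Variables (X Y : topologicalType).

Definition homeomorphism (f : X -> Y) : Prop :=
  exists g : Y -> X,
    [/\ cancel f g, cancel g f, continuous f & continuous g].

Definition local_homeomorphism (f : X -> Y) : Prop :=
  forall x, exists U : set X,
    [/\ open U, U x, open (f @` U) &
        exists g : Y -> X,
          [/\ {in U, cancel f g}, {within U, continuous f} &
              {within f @` U, continuous g}]].

Definition proper (f : X -> Y) : Prop :=
  forall K : set Y, compact K -> compact (f @^-1` K).

End Topology.

Definition topological_graph (V E : topologicalType) (r s : E -> V) : Prop :=
  [/\ continuous r, proper r & local_homeomorphism s].

Section Partitions.
Variables (R : realType) (A : triple R) (b : edge_family A).

(* A partition is given by the set of its components, which is also used as its
   index set Lambda. *)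
Definition is_partition (P : set (set (edge b))) : Prop :=
  [/\ forall E, P E -> E !=set0,
      forall E F, P E -> P F -> E `&` F !=set0 -> E = F &
      \bigcup_(E in P) E = setT].

Definition distinct_sources (P : set (set (edge b))) : Prop :=
  forall E, P E -> {in E &, injective (@src _ _ b)}.

(* E_Lambda, with the subspace topology *)
Definition partition_edges (P : set (set (edge b))) :
    set (discrete_topology (set_type P) * character A) :=
  [set p | exists e, set_val (p.1 : set_type P) e /\ src e = p.2].
Arguments partition_edges : clear implicits.

Definition part_block (P : set (set (edge b))) (x : partition_edges P) :
  set_type P := (set_val x).1.

Definition part_src (P : set (set (edge b))) (x : partition_edges P) :
  character A := (set_val x).2.

Lemma part_edge_subproof (P : set (set (edge b))) (x : partition_edges P) :
  exists e, set_val (part_block x) e /\ src e = part_src x.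
Proof. exact: set_mem (valP x). Qed.

Definition part_rng (P : set (set (edge b))) (x : partition_edges P) :
  character A := rng (sval (cid (part_edge_subproof x))).

Definition topological_partition : set (set (set (edge b))) :=
  [set P | [/\ is_partition P, distinct_sources P &
               topological_graph (@part_rng P) (@part_src P)]].

Definition part_equiv (P : set (set (edge b))) (e f : edge b) : Prop :=
  exists E, [/\ P E, E e & E f].

Definition part_le (P Q : set (set (edge b))) : Prop :=
  forall e f, part_equiv Q e f -> part_equiv P e f.

Definition T3_mx (e f : edge b) (a : A) : 'M[R[i]]_3 :=
  seqmx 3 [:: [:: rng e (tr_phi A a); edge_coef e a       ; edge_coef f a       ];
              [:: 0                 ; src e (tr_phi A a)  ; 0                   ];
              [:: 0                 ; 0                   ; src f (tr_phi A a) ]].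

Definition coloring (P : set (set (edge b))) : set (set_type P -> nat) :=
  [set f | forall l m : set_type P, l <> m ->
     (exists e1 e2, [/\ set_val l e1, set_val m e2, rng e1 = rng e2 &
                        cc_rep (T3_mx e1 e2)]) ->
     f l <> f m].

(* the permutation of the countable index set is one of [set_type P] *)
Definition coloring_le (P : set (set (edge b))) (f g : set_type P -> nat) :
    Prop :=
  exists s : set_type P -> set_type P,
    bijective s /\ forall l, (f l <= g (s l))%N.

(* A pair (P, f) stands for the topological graph
   (V(A), partition_edges P, part_rng, part_src) with the edge-coloring f. *)
Definition colored_partition : Type :=
  {P : set (set (edge b)) & set_type P -> nat}.

Definition colored_graphs : set colored_partition :=
  [set X | [/\ topological_partition (projT1 X), countable (projT1 X) &
               coloring (projT2 X)]].

End Partitions.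

Arguments partition_edges {R A b} P _.
Arguments coloring {R A b} P _.

(* A completely isometric isomorphism of the algebras which carries the map phi
   of A to that of B; it then maps the diagonal of A onto that of B. The graph
   depends on phi: for the disc algebra with pi the identity, phi(f) = f(0)
   gives one loop and phi(f) = f(1) gives none. *)
Structure triple_iso (R : realType) (A B : triple R) := TripleIso {
  iso_fun :> {linear A -> B} ;
  iso_bij : bijective iso_fun ;
  iso_mul : forall a b, iso_fun (oa_mul a b) = oa_mul (iso_fun a) (iso_fun b) ;
  iso_isometric : forall n (a : 'M[A]_n),
    oa_mxnorm (map_mx iso_fun a) = oa_mxnorm a ;
  iso_phi : forall a, iso_fun (val (tr_phi A a)) = val (tr_phi B (iso_fun a))
}.

Section Isomorphism.
Variables (R : realType) (A B : triple R) (pi : triple_iso A B).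

Lemma iso_inv_subproof (y : B) : exists x : A, pi x = y.
Proof. by have [g _ gK] := iso_bij pi; exists (g y). Qed.

Definition iso_inv (y : B) : A := sval (cid (iso_inv_subproof y)).

Lemma iso_invK : cancel iso_inv pi.
Proof. by move=> y; rewrite /iso_inv; case: cid. Qed.

Lemma iso_funK : cancel pi iso_inv.
Proof. by move=> x; apply: (bij_inj (iso_bij pi)); rewrite iso_invK. Qed.

Lemma iso_inv_linear : linear iso_inv.
Proof.
by move=> c x y; apply: (bij_inj (iso_bij pi)); rewrite linearP !iso_invK.
Qed.

Lemma iso_inv_mul (x y : B) : iso_inv (oa_mul x y) = oa_mul (iso_inv x) (iso_inv y).
Proof. by apply: (bij_inj (iso_bij pi)); rewrite iso_mul !iso_invK. Qed.

Lemma iso_inv_diag_subproof (d : diag B) : diag_pred (iso_inv (val d)).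
Proof.
have <- : val (tr_phi A (iso_inv (val d))) = iso_inv (val d).
  apply: (bij_inj (iso_bij pi)); rewrite iso_phi iso_invK.
  by rewrite tr_phi_id.
exact: valP.
Qed.

Definition iso_inv_diag (d : diag B) : diag A :=
  Sub (iso_inv (val d)) (iso_inv_diag_subproof d).

(* pi(v) = v \o pi^-1 *)
Definition iso_char_fun (v : character A) (d : diag B) : R[i] :=
  v (iso_inv_diag d).

Lemma iso_char_scalar v : scalar (iso_char_fun v).
Proof.
move=> c d d'; rewrite /iso_char_fun -char_scalar; congr (v _).
by apply: val_inj; rewrite /= iso_inv_linear.
Qed.

Lemma iso_char_mul v d d' :
  iso_char_fun v (diag_mul d d') = iso_char_fun v d * iso_char_fun v d'.
Proof.
rewrite /iso_char_fun -char_mul; congr (v _).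
by apply: val_inj; rewrite /= iso_inv_mul.
Qed.

Lemma iso_diag_subproof (d : diag A) : diag_pred (pi (val d)).
Proof. by rewrite -{1}(tr_phi_id d) iso_phi; exact: valP. Qed.

Lemma iso_char_neq0 v : exists d, iso_char_fun v d != 0.
Proof.
have [d vd] := char_neq0 v.
pose d' : diag B := Sub (pi (val d)) (iso_diag_subproof d).
exists d'; rewrite /iso_char_fun; suff -> : iso_inv_diag d' = d by [].
by apply: val_inj; rewrite /= iso_funK.
Qed.

Definition iso_char (v : character A) : character B :=
  Character (iso_char_scalar v) (iso_char_mul v) (iso_char_neq0 v).

Lemma iso_ker_subproof (x : kerphi A) : kerphi_pred (pi (val x)).
Proof.
rewrite /kerphi_pred; apply/eqP; apply: val_inj; rewrite -iso_phi.
by have /eqP -> : kerphi_pred (val x) := valP x; rewrite /= linear0.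
Qed.

Definition iso_ker (x : kerphi A) : kerphi B :=
  Sub (pi (val x)) (iso_ker_subproof x).

(* the map E_{w,v} -> E_{pi(w),pi(v)} induced by pi *)
Definition iso_edge_space (w v : character A) (e : edge_space w v) :
    edge_space (iso_char w) (iso_char v) :=
  \pi_(edge_space (iso_char w) (iso_char v)) (iso_ker (repr e)).

(* [theta] is a bijection of E(A) onto E(B) over the map v |-> pi(v) on
   vertices, coming from the vector space isomorphisms [Phi]. *)
Definition graph_iso (bA : edge_family A) (bB : edge_family B)
    (Phi : forall w v : character A,
             edge_space w v -> edge_space (iso_char w) (iso_char v))
    (theta : edge bA -> edge bB) : Prop :=
  [/\ forall w v, linear (Phi w v) /\ bijective (Phi w v),
      bijective iso_char,
      bijective theta &
      forall e, exists h : bB (iso_char (rng e)) (iso_char (src e))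
                             (Phi _ _ (edge_vec e)),
        theta e = Edge h].

Arguments graph_iso {bA bB} Phi theta.

Section Induced.
Variables (bA : edge_family A) (bB : edge_family B) (theta : edge bA -> edge bB).

Definition part_map (P : set (set (edge bA))) : set (set (edge bB)) :=
  [set theta @` E | E in P].

Definition block_map (P : set (set (edge bA))) (l : set_type P) :
  set_type (part_map P) := SigSub (mem_set (imageP _ (set_mem (valP l)))).

(* isomorphism of edge-colored topological graphs over v |-> pi(v) and theta *)
Definition colored_graph_iso (X : colored_partition bA)
    (Y : colored_partition bB) : Prop :=
  projT1 Y = part_map (projT1 X) /\
  homeomorphism iso_char /\
  exists h : partition_edges (projT1 X) -> partition_edges (projT1 Y),
    homeomorphism h /\
    forall x, [/\ part_src (h x) = iso_char (part_src x),
                  part_rng (h x) = iso_char (part_rng x),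
                  set_val (part_block (h x)) = theta @` set_val (part_block x) &
                  projT2 Y (part_block (h x)) = projT2 X (part_block x)].

End Induced.
End Isomorphism.

Arguments graph_iso {R A B} pi {bA bB} Phi theta.
Arguments colored_graph_iso {R A B} pi {bA bB} theta X Y.

(* Main.v *)
(* A completely isometric isomorphism pi intertwining the maps phi carries every
   ingredient of the invariants from A to B. Composition with pi^-1 sends the
   completely contractive representations of A to those of B, hence pi(K_{w,v}) =
   K_{pi(w),pi(v)}, and pi induces isomorphisms of the spaces E_{w,v} under which
   the coordinate functionals t_e correspond; it acts on characters by a
   homeomorphism. For unrelated choices of bases, (1) also needs that two Hamel
   bases of a vector space are equipotent: in the infinite case each basis is
   covered by the finite supports of the other one, and kappa * aleph_0 = kappa. *)

From HB Require Import structures.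
From Stdlib Require Eqdep_dec.
Require Import Defs.
From mathcomp Require Import all_boot all_order all_algebra.
From mathcomp Require Import all_classical all_reals all_analysis.
From mathcomp Require Import complex.

Local Open Scope classical_set_scope.

Set Implicit Arguments.
Unset Strict Implicit.
Unset Printing Implicit Defensive.

Import Order.TTheory GRing.Theory Num.Theory.

(** * Hamel bases *)

(** Unrelated choices of bases need not correspond under the map induced by [pi], so (1) and (5)
    work with arbitrary linear isomorphisms [Phi]. In (3), (6) and (7) the map of edge spaces has to
    be [iso_edge_space]: the functionals t_e are read off through q, and it is the induced map that
    commutes with q. The formal obstacle is that [edge_space w v] is a type depending on two
    characters, and going to [B] and back returns [w] and [v] only up to a provable equality.
    Applying a forward result to the inverse isomorphism is therefore harmless for characters,
    representations and the sets K_{w,v}, but gives maps of edge spaces with the wrong codomain;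
    inverses on edge spaces are built by hand, and those on edges come from injectivity and
    surjectivity. *)

Section Cardinality.
Local Open Scope card_scope.

Lemma card_le_inj (T U : Type) (A : set T) (B : set U) (f : T -> U) :
  {homo f : x / A x >-> B x} -> set_inj A f -> A #<= B.
Proof.
move=> AB fI.
have [g] : $|{injfun A >-> B}| by apply/injfunPex; exists f.
exact: inj_card_le.
Qed.

(** The element [u] is a junk value, taken off [A]. *)
Lemma card_le_injP (T U : Type) (u : U) (A : set T) (B : set U) : A #<= B ->
  exists f : T -> U, {homo f : x / A x >-> B x} /\ set_inj A f.
Proof.
move=> /card_leP[f].
pose g x := if pselect (A x) is left Ax then set_val (f (SigSub (mem_set Ax))) else u.
exists g; split=> [x Ax|x y /set_mem Ax /set_mem Ay]; rewrite /g.
  by case: pselect => // Ax'; exact: set_valP.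
case: pselect => // Ax'; case: pselect => // Ay' /val_inj /inj.
by move=> /(_ (mem_set I) (mem_set I)) [].
Qed.

Lemma card_eq_can (T U : Type) (t : T) (u : U) (A : set T) (B : set U) :
  (A #= B)%card -> exists (f : T -> U) (g : U -> T),
    [/\ {homo f : x / A x >-> B x}, {homo g : x / B x >-> A x},
        forall x, A x -> g (f x) = x & forall y, B y -> f (g y) = y].
Proof.
move=> /card_eqP[h]; have [h' hK h'K] := @bijTT _ _ h.
pose f x := if pselect (A x) is left Ax then set_val (h (SigSub (mem_set Ax))) else u.
pose g y := if pselect (B y) is left By
            then set_val (h' (SigSub (mem_set By))) else t.
exists f, g; split.
- by move=> x Ax; rewrite /f; case: pselect => // Ax'; exact: set_valP.
- by move=> y By; rewrite /g; case: pselect => // By'; exact: set_valP.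
- move=> x Ax; rewrite /f; case: pselect => // Ax'; rewrite /g.
  case: pselect => [Bh|[]]; last exact: set_valP.
  rewrite (_ : SigSub _ = h (SigSub (mem_set Ax'))) ?hK //.
  exact: val_inj.
- move=> y By; rewrite /g; case: pselect => // By'; rewrite /f.
  case: pselect => [Ah|[]]; last exact: set_valP.
  rewrite (_ : SigSub _ = h' (SigSub (mem_set By'))) ?h'K //.
  exact: val_inj.
Qed.

(* A is partitioned into a maximal family E of countably infinite pieces and a
   finite remainder, so that A * nat embeds in E * nat * nat, hence in
   E * nat, hence in A. *)
Lemma infinite_setX_nat_le (T : Type) (A : set T) :
  infinite_set A -> A `*` [set: nat] #<= A.
Proof.
move=> Ainf.
have [t0 At0] := infinite_setN0 Ainf.
pose D := [set f : nat -> T | injective f /\ forall n, A (f n)].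
have [E [ED tE maxE]] :=
  ex_maximal_disjoint_subcollection (fun f : nat -> T => range f) D.
have E_eq f g m n : E f -> E g -> f m = g n -> f = g.
  move=> Ef Eg fg; apply: tE => //; exists (f m).
  by split; [exists m|exists n].
pose L := A `\` \bigcup_(f in E) range f.
(* Otherwise a sequence of distinct points of [L] could be added to [E], against maximality. *)
have Lfin : finite_set L.
  apply: contrapT => /infiniteP /(card_le_injP t0)[f [fL fI]].
  apply: (maxE (E `|` [set f])).
  - split; first by move=> g; left.
    move=> /(_ f) sub; have /sub Ef : (E `|` [set f]) f by right.
    by have [_] := fL 0%N I; apply; exists f => //; exists 0%N.
  - move=> g [/ED//|->]; split=> [m n|n]; last by have [] := fL n I.
    by apply: fI; exact: mem_set.
  - move=> g h [Eg|->] [Eh|->] // [x [[m _ gx] [n _ hx]]].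
    + by apply: (E_eq _ _ m n) => //; rewrite gx hx.
    + have [_] := fL n I; case; exists g => //; exists m => //.
      by rewrite gx hx.
    + have [_] := fL m I; case; exists h => //; exists n => //.
      by rewrite gx hx.
(* If [E] were empty, [A] would equal the finite remainder [L]. The sequence [f0] serves as a dummy
   first component for the points of [L]. *)
have [f0 Ef0] : E !=set0.
  apply/set0P/negP => /eqP E0; apply: Ainf; apply: sub_finite_set Lfin.
  by move=> x Ax; split=> // -[f]; rewrite E0.
have [l [_ lI]] := card_le_injP 0%N (finite_set_countable Lfin).
(* Even codes are reserved for the remainder and odd codes for positions in a sequence of [E], so
   parity separates the two cases. *)
have /choice[h hP] : forall x, exists p : (nat -> T) * nat, A x ->
    E p.1 /\ ((L x /\ p.2 = (l x).*2) \/ (exists n, p.2 = n.*2.+1 /\ p.1 n = x)).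
  move=> x; have [Lx|nLx] := pselect (L x).
    by exists (f0, (l x).*2); split => //; left.
  have [Ax|nAx] := pselect (A x); last by exists (f0, 0%N).
  have [f Ef [n _ fx]] : (\bigcup_(f in E) range f) x.
    by apply: contrapT => nx; apply: nLx.
  by exists (f, n.*2.+1); split => //; right; exists n.
have hI x y : A x -> A y -> h x = h y -> x = y.
  move=> /hP[Ex Hx] /hP[Ey Hy] hxy; rewrite hxy in Ex Hx.
  case: Hx => [[Lx e]|[n [e <-]]]; case: Hy => [[Ly]|[m []]]; rewrite e.
  - by move=> /double_inj /lI; apply; exact: mem_set.
  - by move=> /(congr1 odd) /=; rewrite !odd_double.
  - by move=> /(congr1 odd) /=; rewrite !odd_double.
  - by move=> [/double_inj ->].
apply: (@card_le_trans _ _ _ (E `*` [set: nat])).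
  apply: (@card_le_inj _ _ _ _
    (fun p : T * nat => ((h p.1).1, pickle ((h p.1).2, p.2)))).
    by move=> [x n] [/= Ax _]; split => //=; case: (hP x Ax).
  move=> [x m] [y n] /set_mem[/= Ax _] /set_mem[/= Ay _] [h1].
  move=> /(pcan_inj pickleK) [h2 ->]; congr (_, _).
  by apply: hI => //; case: (h x) (h y) h1 h2 => ? ? [? ?] /= -> ->.
(* Evaluation is injective because the ranges are disjoint and each sequence is injective. *)
apply: (@card_le_inj _ _ _ _ (fun p : (nat -> T) * nat => p.1 p.2)).
  by move=> [f n] [/= /ED[_ fA] _]; exact: fA.
move=> [f m] [g n] /set_mem[/= Ef _] /set_mem[/= Eg _] fg.
have fge := E_eq _ _ _ _ Ef Eg fg; rewrite -fge in fg *.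
by have [fI _] := ED _ Ef; rewrite (fI _ _ fg).
Qed.

End Cardinality.

Section LinearSum.
Local Open Scope ring_scope.

Lemma linear_sumE (K : fieldType) (V W : lmodType K) (L : V -> W) (s : seq V) (c : V -> K) :
  linear L -> L (\sum_(y <- s) c y *: y) = \sum_(y <- s) c y *: L y.
Proof.
move=> lL; have L0 : L 0 = 0.
  by have := lL (-1) 0 0; rewrite scaler0 addr0 scaleN1r addNr.
elim: s => [|x s IHs]; first by rewrite !big_nil.
by rewrite !big_cons lL IHs.
Qed.

End LinearSum.

(** * Linear extension from a basis and coordinate functionals *)

Section HamelBasis.
Variables (K : fieldType) (V : lmodType K) (b : set V).
Local Open Scope ring_scope.
Hypothesis bB : hamel_basis b.

(** As [c] must vanish off [s], the function [c] is determined by [x], although the list [s] is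
    not. *)
Let decomp (x : V) (s : seq V) (c : V -> K) :=
  [/\ uniq s, [set` s] `<=` b, forall y, y \notin s -> c y = 0 &
      x = \sum_(y <- s) c y *: y].

Let decomp_widen (W : lmodType K) (g : V -> W) (s t : seq V) (c : V -> K) :
  uniq s -> (forall y, y \notin s -> c y = 0) -> uniq t -> {subset s <= t} ->
  \sum_(y <- s) c y *: g y = \sum_(y <- t) c y *: g y.
Proof.
move=> us cs ut st; rewrite [RHS](bigID (mem s)) /= [X in _ + X]big1; last first.
  by move=> y /cs ->; rewrite scale0r.
rewrite addr0 -[RHS]big_filter; apply: perm_big; apply: uniq_perm => //.
  exact: filter_uniq.
by move=> y; rewrite mem_filter; case: (boolP (y \in s)) => //= /st ->.
Qed.

Let decomp_uniq (x : V) s t c d : decomp x s c -> decomp x t d -> c = d.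
Proof.
move=> [us sb cs xs] [ut tb dt xt]; apply/funext => y.
pose u := undup (s ++ t).
have uu : uniq u by exact: undup_uniq.
have su : {subset s <= u} by move=> z zs; rewrite mem_undup mem_cat zs.
have tu : {subset t <= u} by move=> z zs; rewrite mem_undup mem_cat zs orbT.
have [yu|] := boolP (y \in u); last first.
  by rewrite mem_undup mem_cat negb_or => /andP[/cs -> /dt ->].
apply/eqP; rewrite -subr_eq0; apply/eqP.
apply: (bB.1 u (fun y => c y - d y)) => //.
  by move=> z /=; rewrite mem_undup mem_cat => /orP[/sb|/tb].
under eq_bigr do rewrite scalerBl.
rewrite sumrB -(decomp_widen idfun us cs uu su).
by rewrite -(decomp_widen idfun ut dt uu tu) /= -xs -xt subrr.
Qed.

Let decomp_ex (x : V) : exists p : seq V * (V -> K), decomp x p.1 p.2.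
Proof.
have [s [c [sb ->]]] := bB.2 x.
(* The spanning list may repeat vectors; merging the repetitions multiplies each coefficient by its
   multiplicity. *)
exists (undup s, fun y => (c y) *+ (count_mem y s)); split => //=.
- exact: undup_uniq.
- by move=> y /=; rewrite mem_undup => /sb.
- by move=> y; rewrite mem_undup => /count_memPn ->.
have cE y : (c y *+ count_mem y s) *: y = \sum_(z <- s | z == y) c z *: z.
  rewrite -big_filter (eq_big_seq (fun=> c y *: y)).
    by rewrite big_const_seq count_predT size_filter iter_addr_0 scalerMnl.
  by move=> z; rewrite mem_filter => /andP[/eqP ->].
under [RHS]eq_bigr do rewrite cE.
rewrite (exchange_big_dep predT) //= [LHS]big_seq [RHS]big_seq.
apply: eq_bigr => y ys.
rewrite -big_filter (_ : [seq _ <- _ | _] = [:: y]) ?big_seq1 //.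
apply: perm_small_eq => //; apply: uniq_perm => //.
  exact/filter_uniq/undup_uniq.
move=> z; rewrite mem_filter mem_undup inE eq_sym.
by apply/andP/idP => [[]//|/eqP <-]; split; [exact: eqxx|exact: ys].
Qed.

Lemma hamel_basis_ext (W : lmodType K) (g : V -> W) :
  exists L : V -> W, linear L /\ forall y, b y -> L y = g y.
Proof.
have [D DP] := choice decomp_ex.
pose L x := \sum_(y <- (D x).1) (D x).2 y *: g y.
(* [L] can be computed from any decomposition, in particular from one over a list common to several
   vectors, which gives linearity below. *)
have LE x s c : decomp x s c -> L x = \sum_(y <- s) c y *: g y.
  move=> xsc; have cE := decomp_uniq (DP x) xsc; rewrite /L -cE.
  have [us _ cs _] := xsc; have [uD _ cD _] := DP x.
  rewrite (decomp_widen g uD cD (undup_uniq (s ++ (D x).1))); last first.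
    by move=> z zs; rewrite mem_undup mem_cat zs orbT.
  rewrite -cE in cs; rewrite (decomp_widen g us cs (undup_uniq (s ++ (D x).1))) //.
  by move=> z zs; rewrite mem_undup mem_cat zs.
exists L; split; last first.
  move=> y yb; rewrite (LE y [:: y] (fun z => (z == y)%:R)).
    by rewrite big_seq1 eqxx scale1r.
  split => //; first by move=> z /=; rewrite inE => /eqP ->.
    by move=> z; rewrite inE => /negPf ->.
  by rewrite big_seq1 eqxx scale1r.
move=> k x y; have [ux xb xs xE] := DP x; have [uy yb ys yE] := DP y.
pose u := undup ((D x).1 ++ (D y).1).
have uu : uniq u by exact: undup_uniq.
have xu : {subset (D x).1 <= u} by move=> z zs; rewrite mem_undup mem_cat zs.
have yu : {subset (D y).1 <= u}.
  by move=> z zs; rewrite mem_undup mem_cat zs orbT.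
rewrite (LE (k *: x + y) u (fun z => k * (D x).2 z + (D y).2 z)).
  rewrite /L (decomp_widen g ux xs uu xu) (decomp_widen g uy ys uu yu).
  rewrite scaler_sumr -big_split /=; apply: eq_bigr => z _.
  by rewrite scalerDl scalerA.
split => //.
- by move=> z /=; rewrite mem_undup mem_cat => /orP[/xb|/yb].
- move=> z; rewrite mem_undup mem_cat negb_or => /andP[/xs -> /ys ->].
  by rewrite mulr0 addr0.
rewrite {1}xE {1}yE (decomp_widen idfun ux xs uu xu).
rewrite (decomp_widen idfun uy ys uu yu) /=.
rewrite scaler_sumr -big_split /=; apply: eq_bigr => z _.
by rewrite scalerDl scalerA.
Qed.

Lemma hamel_basis_linear_eq (W : lmodType K) (L M : V -> W) :
  linear L -> linear M -> (forall y, b y -> L y = M y) -> L =1 M.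
Proof.
move=> lL lM LM x; have [s [c [sb ->]]] := bB.2 x.
rewrite !linear_sumE // big_seq [RHS]big_seq; apply: eq_bigr => y ys.
by rewrite LM //; apply: sb.
Qed.

(** Linear extension of the indicator of [e] inhabits the set from which [coord] picks, so its
    default is never taken. *)
Lemma coordP (e : V) : b e ->
  scalar (Defs.coord b e) /\ forall f, b f -> Defs.coord b e f = (f == e)%:R.
Proof.
move=> be; rewrite /Defs.coord.
case: xgetP => [t -> //|noc]; exfalso.
have [L [lL LE]] := hamel_basis_ext (fun f => (f == e)%:R : K^o).
exact: noc L (conj lL LE).
Qed.

Lemma coord_unique (e : V) (t : V -> K) : b e ->
  scalar t -> (forall f, b f -> t f = (f == e)%:R) -> t = Defs.coord b e.
Proof.
move=> be lt tE; have [lc cE] := coordP be; apply/funext.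
by apply: (@hamel_basis_linear_eq K^o) => // f bf; rewrite tE // cE.
Qed.

End HamelBasis.

(** * Equipotence of Hamel bases *)

Section HamelBasisCard.
Variables (K : fieldType) (V : lmodType K).
Local Open Scope ring_scope.
Local Open Scope card_scope.

(** If [t] were longer than [s], the matrix expressing [t] in terms of [s] would have more rows than
    columns; a nonzero vector of its left kernel is a linear relation on [t]. *)
Lemma free_seq_size_le (s t : seq V) :
  uniq t ->
  (forall c : V -> K, \sum_(x <- t) c x *: x = 0 -> forall x, x \in t -> c x = 0) ->
  (forall x, x \in t -> exists c : V -> K, x = \sum_(y <- s) c y *: y) ->
  (size t <= size s)%N.
Proof.
move=> ut tfree tspan; rewrite leqNgt; apply/negP => lt_st.
have /choice[C CE] : forall x, exists c : V -> K, x \in t -> x = \sum_(y <- s) c y *: y.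
  move=> x; case: (boolP (x \in t)) => [/tspan[c cE]|_]; first by exists c.
  by exists (fun=> 0).
pose M : 'M[K]_(size t, size s) := \matrix_(i, j) C t`_i s`_j.
have /matrix0Pn[i [j uij]] : kermx M != 0.
  rewrite kermx_eq0 /row_free; apply/negP => /eqP rM.
  by move: (rank_leq_col M); rewrite rM leqNgt lt_st.
pose u := row i (kermx M).
have uM : u *m M = 0 by apply/sub_kermxP; exact: row_sub.
pose c x := if insub (index x t) is Some k then u ord0 k else 0.
have cE (k : 'I_(size t)) : c t`_k = u ord0 k.
  by rewrite /c index_uniq // valK.
suff /tfree/(_ t`_j (mem_nth _ _)) : \sum_(x <- t) c x *: x = 0.
  by move=> /(_ (ltn_ord j)); rewrite cE mxE => /eqP; rewrite (negPf uij).
rewrite (big_nth 0) big_mkord.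
under eq_bigr => k _.
  rewrite cE {1}(CE t`_k (mem_nth _ _)) // (big_nth 0) big_mkord scaler_sumr.
  under eq_bigr do rewrite scalerA.
  over.
rewrite exchange_big big1 //= => k _; rewrite -scaler_suml.
have <- : (u *m M) ord0 k = \sum_(i < size t) u ord0 i * C t`_i s`_k.
  by rewrite mxE; apply: eq_bigr => l _; rewrite [M l k]mxE.
by rewrite uM mxE scale0r.
Qed.

(* Every vector of [c] occurs with a nonzero coordinate in the expansion of some
   vector of [b]: otherwise [b] would lie in the kernel of its coordinate. *)
Lemma hamel_basis_card_le (b c : set V) :
  hamel_basis b -> hamel_basis c -> c #<= b.
Proof.
move=> bB cB; have [bfin|binf] := pselect (finite_set b).
  have /finite_seqP[s bE] := bfin.
  have us := undup_uniq s; move: us; set s' := undup s => us.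
  have mem_s y : (y \in s') <-> b y by rewrite bE mem_undup.
  have cs (t : seq V) : uniq t -> [set` t] `<=` c -> (size t <= size s')%N.
    move=> ut tc; apply: free_seq_size_le => // [d|x _].
      exact: cB.1.
    (* Both sides of the coordinate expansion are linear in [x], so it suffices to compare them on
       [b]. *)
    exists (fun y => Defs.coord b y x).
    apply: (hamel_basis_linear_eq bB (L := idfun)
              (M := fun x => \sum_(y <- s') Defs.coord b y x *: y)) => //.
      move=> k {}x z; rewrite scaler_sumr -big_split /=.
      rewrite big_seq [RHS]big_seq; apply: eq_bigr => y /mem_s yb.
      by have [-> _] := coordP bB yb; rewrite scalerDl scalerA.
    move=> y by_; rewrite /= (bigD1_seq y) //=; last exact/mem_s.
    have [_ ->//] := coordP bB by_; rewrite eqxx scale1r.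
    rewrite big_seq_cond big1 ?addr0 // => z /andP[/mem_s zb zy].
    by have [_ ->//] := coordP bB zb; rewrite eq_sym (negPf zy) scale0r.
  (* An infinite [c] would contain [(size s').+1] distinct vectors, one more than [cs] allows. *)
  have /finite_seqP[t cE] : finite_set c.
    apply: contrapT => /infiniteP /(card_le_injP (0 : V))[f [fc fI]].
    have := cs [seq f n | n <- iota 0 (size s').+1].
    rewrite size_map size_iota ltnn => cs0; suff : false by [].
    apply: cs0.
      rewrite map_inj_uniq ?iota_uniq // => m n.
      by apply: fI; exact: mem_set.
    move=> x xs; have /mapP[n _ ->] : x \in [seq f n | n <- iota 0 (size s').+1] by [].
    exact: fc.
  have ut := undup_uniq t; move: ut; set t' := undup t => ut.
  have mem_t y : (y \in t') <-> c y by rewrite cE mem_undup.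
  have ts : (size t' <= size s')%N by apply: cs => // y /= /mem_t.
  have lt_s y : c y -> (index y t' < size s')%N.
    by move=> /mem_t yt; apply: leq_trans ts; rewrite index_mem.
  apply: (@card_le_inj _ _ _ _ (fun y => s'`_(index y t'))) => [y cy|].
    by apply/mem_s/mem_nth/lt_s.
  move=> y z /set_mem cy /set_mem cz /eqP.
  rewrite nth_uniq ?lt_s // => /eqP yz.
  by rewrite -(nth_index 0 ((mem_t y).2 cy)) yz nth_index //; apply/mem_t.
(* Infinite case: [S x] is a finite list of vectors of [c] spanning [x], and [h y] a vector of [b]
   whose list contains [y]. *)
have /choice[S SP] : forall x : V, exists s : seq V,
    [set` s] `<=` c /\ exists d : V -> K, x = \sum_(y <- s) d y *: y.
  by move=> x; have [s [d [sc xE]]] := cB.2 x; exists s; split=> //; exists d.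
have /choice[h hP] : forall y, exists x, c y -> b x /\ y \in S x.
  move=> y; have [cy|] := pselect (c y); last by exists y.
  apply: contrapT => noh.
  have [lc cE] := coordP cB cy.
  have /(_ y) : Defs.coord c y =1 (fun=> 0).
    apply: (hamel_basis_linear_eq (W := K^o) bB) => //.
      by move=> k x z; rewrite scaler0 addr0.
    move=> x bx; have [Sc [d ->]] := SP x.
    rewrite (linear_sumE (W := K^o)) // big_seq big1 // => z zS.
    rewrite cE; last exact: Sc.
    case: eqP => [zy|]; last by rewrite scaler0.
    by exfalso; apply: noh; exists x; rewrite -zy.
  by rewrite cE // eqxx => /eqP; rewrite oner_eq0.
(* A vector [y] of [c] is recovered from [h y] and its position in [S (h y)]. *)
apply: card_le_trans (infinite_setX_nat_le binf).
apply: (@card_le_inj _ _ _ _ (fun y => (h y, index y (S (h y))))).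
  by move=> y /hP[].
move=> y z /set_mem/hP[_ yS] /set_mem/hP[_ zS] [hyz]; rewrite hyz in yS *.
by move=> /(congr1 (nth 0 (S (h z)))); rewrite !nth_index.
Qed.

End HamelBasisCard.

Section HamelBasisIso.
Variables (K : fieldType) (V W : lmodType K).
Local Open Scope ring_scope.
Variables (L : V -> W) (M : W -> V).
Hypotheses (lL : linear L) (LK : cancel L M) (MK : cancel M L).

Lemma linear_can : linear M.
Proof. by move=> k x y; apply: (can_inj LK); rewrite lL !MK. Qed.

Lemma hamel_basis_preimage (c : set W) :
  hamel_basis c -> hamel_basis (L @^-1` c).
Proof.
move=> [cfree cspan]; split=> [s d us sc sum0 x xs|x].
  rewrite -(LK x); apply: (cfree [seq L y | y <- s] (d \o M)).
  - by rewrite map_inj_uniq //; exact: can_inj LK.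
  - by move=> y ys; have /mapP[z /sc zc ->] : y \in [seq L y | y <- s] by [].
  - rewrite big_map /=; under eq_bigr do rewrite LK.
    by rewrite -linear_sumE // sum0; have := linear_sumE [::] d lL; rewrite !big_nil.
  - exact: map_f.
have [s [d [sc Lx]]] := cspan (L x).
exists [seq M y | y <- s], (d \o L); split.
  move=> y ys; have /mapP[z zs ->] : y \in [seq M y | y <- s] by [].
  by rewrite /preimage /= MK; exact: sc.
rewrite big_map /=; under eq_bigr do rewrite MK.
by rewrite -(linear_sumE s d linear_can) -Lx LK.
Qed.

Lemma coord_preimage (c : set W) (e x : V) : hamel_basis c -> c (L e) ->
  Defs.coord (L @^-1` c) e x = Defs.coord c (L e) (L x).
Proof.
move=> cB ce; have [lc cE] := coordP cB ce.
have -> // : Defs.coord (L @^-1` c) e = Defs.coord c (L e) \o L.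
apply/esym/(coord_unique (hamel_basis_preimage cB)) => //.
  by move=> k y z; rewrite /= lL lc.
by move=> f cf; rewrite /= cE // (inj_eq (can_inj LK)).
Qed.

(** [L] need not carry [b] to [c]. Both [b] and the preimage of [c] are bases of [V]; a bijection
    between them extends to an automorphism of [V], which is then followed by [L]. *)
Lemma hamel_basis_iso (b : set V) (c : set W) :
  hamel_basis b -> hamel_basis c ->
  exists P : V -> W, [/\ linear P, bijective P & forall x, b x <-> c (P x)].
Proof.
move=> bB cB; have cLB := hamel_basis_preimage cB.
have /(card_eq_can (0 : V) (0 : V))[f [g [fP gP fK gK]]] :
    (b #= L @^-1` c)%card.
  by rewrite card_eq_le !hamel_basis_card_le.
have [F [lF FE]] := hamel_basis_ext bB f.
have [G [lG GE]] := hamel_basis_ext cLB g.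
have FK : cancel F G.
  apply: (hamel_basis_linear_eq bB (L := G \o F) (M := idfun)) => // [k x y|x bx].
    by rewrite /= lF lG.
  by rewrite /= FE // GE ?fK //; exact: fP.
have GK : cancel G F.
  apply: (hamel_basis_linear_eq cLB (L := F \o G) (M := idfun)) => // [k x y|x cx].
    by rewrite /= lG lF.
  by rewrite /= GE // FE ?gK //; exact: gP.
exists (L \o F); split.
- by move=> k x y; rewrite /= lF lL.
- by exists (G \o M) => x /=; rewrite ?LK ?FK ?GK ?MK.
- move=> x; split=> [bx|cx]; first by rewrite /= FE //; exact: fP.
  by rewrite -(FK x) GE //; exact: gP.
Qed.

End HamelBasisIso.

(** * Transport along an isomorphism *)

Section InverseIso.
Variables (R : realType) (A B : triple R) (pi : triple_iso A B).
Local Open Scope ring_scope.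

HB.instance Definition _ :=
  GRing.isLinear.Build R[i] B A *:%R (iso_inv pi) (iso_inv_linear pi).

Lemma iso_inv_isometric n (b : 'M[B]_n) :
  oa_mxnorm (map_mx (iso_inv pi) b) = oa_mxnorm b.
Proof.
rewrite -(iso_isometric pi); congr oa_mxnorm.
by apply/matrixP => i j; rewrite !mxE iso_invK.
Qed.

Lemma iso_inv_phi b :
  iso_inv pi (val (tr_phi B b)) = val (tr_phi A (iso_inv pi b)).
Proof. by apply: (bij_inj (iso_bij pi)); rewrite iso_phi !iso_invK. Qed.

Lemma iso_inv_bij : bijective (iso_inv pi).
Proof. by exists pi; [exact: iso_invK|exact: iso_funK]. Qed.

Definition triple_iso_inv : triple_iso B A :=
  @TripleIso R B A (iso_inv pi) iso_inv_bij (iso_inv_mul pi) iso_inv_isometric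
    iso_inv_phi.

(** [iso_inv] picks preimages by choice, so inverting twice does not compute back to [pi]. *)
Lemma iso_inv_invE : iso_inv triple_iso_inv =1 pi.
Proof.
move=> a; apply: (bij_inj iso_inv_bij); rewrite iso_funK.
exact: (iso_invK triple_iso_inv).
Qed.

End InverseIso.

Lemma character_ext (R : realType) (A : opalg R) (v w : character A) :
  (forall d, v d = w d) -> v = w.
Proof.
case: v w => [f sf mf nf] [g sg mg ng] /= /funext fg; rewrite fg in sf mf nf *.
by congr Character; exact: Prop_irrelevance.
Qed.

Section IsoFunctor.
Variables (R : realType) (A B : triple R) (pi : triple_iso A B).
Local Open Scope ring_scope.
Local Notation pi' := (triple_iso_inv pi).

Lemma iso_charE (v : character A) (b : B) :
  iso_char pi v (tr_phi B b) = v (tr_phi A (iso_inv pi b)).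
Proof.
by congr (char_fun v); apply: val_inj; rewrite /= iso_inv_phi.
Qed.

Lemma iso_charK : cancel (iso_char pi) (iso_char pi').
Proof.
move=> v; apply: character_ext => d.
congr (char_fun v); apply: val_inj => /=.
by rewrite iso_inv_invE iso_funK.
Qed.

Lemma iso_char_invK : cancel (iso_char pi') (iso_char pi).
Proof.
move=> v; apply: character_ext => d.
congr (char_fun v); apply: val_inj => /=.
by rewrite iso_inv_invE iso_invK.
Qed.

Lemma iso_char_bij : bijective (iso_char pi).
Proof. by exists (iso_char pi'); [exact: iso_charK|exact: iso_char_invK]. Qed.

(** Contractivity is preserved because the entrywise action of the inverse of [pi] keeps every
    matrix norm. *)
Lemma cc_rep_iso n (T : A -> 'M[R[i]]_n) :
  cc_rep T -> cc_rep (T \o iso_inv pi).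
Proof.
move=> [lT mT uT cT]; split.
- by move=> c x y; rewrite /= iso_inv_linear lT.
- by move=> x y; rewrite /= iso_inv_mul mT.
- by move=> x i j; exact: uT.
- move=> k b; rewrite map_mx_comp -(iso_inv_isometric pi); exact: cT.
Qed.

End IsoFunctor.

Section IsoTransport.
Variables (R : realType) (A B : triple R) (pi : triple_iso A B).
Local Open Scope ring_scope.
Local Notation pi' := (triple_iso_inv pi).

(** The pointwise hypothesis lets this apply directly to explicit matrices such as [T_mx] and
    [T3_mx]. *)
Lemma cc_rep_isoP n (T : A -> 'M[R[i]]_n) (T' : B -> 'M[R[i]]_n) :
  (forall a, T' (pi a) = T a) -> cc_rep T <-> cc_rep T'.
Proof.
move=> TT'; split=> [/(cc_rep_iso pi)|/(cc_rep_iso pi')].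
  by congr cc_rep; apply/funext => b; rewrite /= -TT' iso_invK.
by congr cc_rep; apply/funext => a; rewrite /= iso_inv_invE TT'.
Qed.

Lemma iso_char_funE (v : character A) (a : A) :
  iso_char pi v (tr_phi B (pi a)) = v (tr_phi A a).
Proof. by rewrite iso_charE iso_funK. Qed.

Lemma T_mx_iso (w v : character A) (t : A -> R[i]) (t' : B -> R[i]) (a : A) :
  t' (pi a) = t a ->
  T_mx (iso_char pi w) (iso_char pi v) t' (pi a) = T_mx w v t a.
Proof. by move=> tt'; rewrite /T_mx !iso_char_funE tt'. Qed.

Lemma T_set_iso (w v : character A) (T : A -> 'M[R[i]]_2) :
  T_set w v T -> T_set (iso_char pi w) (iso_char pi v) (T \o iso_inv pi).
Proof.
move=> [cT [t [lt [a ta] TE]]]; split; first exact: cc_rep_iso.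
exists (t \o iso_inv pi); split.
- by move=> c x y; rewrite /= iso_inv_linear lt.
- by exists (pi a); rewrite /= iso_funK.
- apply/funext => b; rewrite /= TE -[in RHS](iso_invK pi b); apply/esym.
  by apply: T_mx_iso; rewrite /= iso_funK.
Qed.

End IsoTransport.

Section EdgeSpaceEq.
Local Open Scope ring_scope.
Local Open Scope quotient_scope.

Lemma pi_edge_eq (R : realType) (A : triple R) (w v : character A) (x y : kerphi A) :
  \pi_(edge_space w v) x = \pi_(edge_space w v) y <-> K_set w v (val (x - y)).
Proof.
split=> [/eqP|Kxy]; last apply/eqP.
  by rewrite -(@Quotient.idealrBE _ (Kker_pred w v)) => /asboolP.
by rewrite -(@Quotient.idealrBE _ (Kker_pred w v)); apply/asboolP.
Qed.

Lemma pi_edgeZ (R : realType) (A : triple R) (w v : character A) (c : R[i])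
    (x : kerphi A) :
  \pi_(edge_space w v) (c *: x) = c *: \pi_(edge_space w v) x.
Proof. exact: pi_scale. Qed.

End EdgeSpaceEq.

(** * The isomorphisms of edge spaces induced by [pi] *)

Section EdgeSpaceIso.
Variables (R : realType) (A B : triple R) (pi : triple_iso A B).
Local Open Scope ring_scope.
Local Notation pi' := (triple_iso_inv pi).

(** Rewriting with [iso_charK] is possible here because [K_set w v] is a subset of [A] for all [w]
    and [v]. *)
Lemma K_set_iso (w v : character A) (a : A) :
  K_set w v a <-> K_set (iso_char pi w) (iso_char pi v) (pi a).
Proof.
split=> Ka T TT.
  have := T_set_iso pi' TT; rewrite !iso_charK => /Ka /=.
  by rewrite iso_inv_invE.
by have := Ka _ (T_set_iso pi TT); rewrite /= iso_funK.
Qed.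

Section Space.
Variables w v : character A.
Local Notation w' := (iso_char pi w).
Local Notation v' := (iso_char pi v).
Local Open Scope quotient_scope.

Lemma iso_ker_linear : linear (iso_ker pi).
Proof. by move=> c x y; apply: val_inj; rewrite /= linearP. Qed.

Lemma iso_ker_inv_subproof (y : kerphi B) : kerphi_pred (iso_inv pi (val y)).
Proof. exact: (iso_ker_subproof pi'). Qed.

Definition iso_ker_inv (y : kerphi B) : kerphi A :=
  Sub (iso_inv pi (val y)) (iso_ker_inv_subproof y).

Lemma iso_ker_sub x y : iso_ker pi (x - y) = iso_ker pi x - iso_ker pi y.
Proof. by apply: val_inj; rewrite /= linearB. Qed.

Lemma iso_edge_space_pi (x : kerphi A) :
  iso_edge_space pi (\pi_(edge_space w v) x) = \pi_(edge_space w' v') (iso_ker pi x).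
Proof.
apply/pi_edge_eq; rewrite -iso_ker_sub /=; apply/K_set_iso/pi_edge_eq.
by rewrite reprK.
Qed.

(** [iso_edge_space pi'] would land in the edge space of the twice transported characters instead of
    [edge_space w v]. *)
Definition iso_edge_space_inv (y : edge_space w' v') : edge_space w v :=
  \pi_(edge_space w v) (iso_ker_inv (repr y)).

Lemma iso_edge_space_invE (y : kerphi B) :
  iso_edge_space_inv (\pi_(edge_space w' v') y) = \pi_(edge_space w v) (iso_ker_inv y).
Proof.
apply/pi_edge_eq/(K_set_iso w v); rewrite /= linearB /= !iso_invK -/(val _).
by move/pi_edge_eq: (reprK (\pi_(edge_space w' v') y)).
Qed.

Lemma iso_edge_spaceK : cancel (@iso_edge_space _ _ _ pi w v) iso_edge_space_inv.
Proof.
move=> x; rewrite -[x]reprK iso_edge_space_pi iso_edge_space_invE.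
by congr (\pi_(edge_space w v) _); apply: val_inj; rewrite /= iso_funK.
Qed.

Lemma iso_edge_space_invK : cancel iso_edge_space_inv (@iso_edge_space _ _ _ pi w v).
Proof.
move=> y; rewrite -[y]reprK iso_edge_space_invE iso_edge_space_pi.
by congr (\pi_(edge_space w' v') _); apply: val_inj; rewrite /= iso_invK.
Qed.

Lemma iso_edge_space_linear : linear (@iso_edge_space _ _ _ pi w v).
Proof.
move=> c x y; rewrite -[x]reprK -[y]reprK !iso_edge_space_pi.
by rewrite -!pi_edgeZ -!pi_edgeD !iso_edge_space_pi iso_ker_linear.
Qed.

Lemma edge_quo_iso (a : A) :
  edge_quo w' v' (pi a) = iso_edge_space pi (edge_quo w v a).
Proof.
rewrite iso_edge_space_pi; congr (\pi_(edge_space w' v') _).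
by apply: val_inj; rewrite /= linearB iso_phi.
Qed.

(** The coordinates of a pulled-back basis are the pulled-back coordinates, so each T_lambda for [A]
    is one for [B] composed with [pi]. *)
Lemma free_basis_preimage (c : set (edge_space w' v')) :
  free_basis c -> free_basis (@iso_edge_space _ _ _ pi w v @^-1` c).
Proof.
have lL := iso_edge_space_linear.
move=> [cB cF]; split.
  exact: (hamel_basis_preimage lL iso_edge_spaceK iso_edge_space_invK).
move=> e ce; apply: (cc_rep_isoP _).2 (cF _ ce) => a; apply: T_mx_iso.
rewrite edge_quo_iso.
by rewrite (coord_preimage lL iso_edge_spaceK iso_edge_space_invK).
Qed.

End Space.
End EdgeSpaceIso.

Lemma surj_inj_bij (T U : Type) (f : T -> U) :
  injective f -> (forall y, exists x, f x = y) -> bijective f.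
Proof.
move=> fI /choice[g gK]; exists g => // x.
by apply: fI; rewrite gK.
Qed.

(** Equal edges have equal endpoints, but comparing their vectors is an equality in a dependent
    pair; it reduces to an ordinary one since equality of pairs of characters is decidable,
    classically. *)
Lemma edge_vec_inj (R : realType) (A : triple R) (b : edge_family A) (w v : character A)
    (x y : edge_space w v) (h : b w v x) (k : b w v y) :
  Edge h = Edge k -> x = y.
Proof.
pose tag (e : edge b) : {p : character A * character A & edge_space p.1 p.2} :=
  existT (fun p => edge_space p.1 p.2) (rng e, src e) (edge_vec e).
move=> /(congr1 tag) /=; apply: Eqdep_dec.inj_pair2_eq_dec.
exact: eq_comparable.
Qed.

(** * Bijections of edges and the coefficients they preserve *)

Section EdgeBijection.
Variables (R : realType) (A B : triple R) (pi : triple_iso A B).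
Variables (bA : edge_family A) (bB : edge_family B).
Variable Phi : forall w v : character A,
  edge_space w v -> edge_space (iso_char pi w) (iso_char pi v).
Local Open Scope ring_scope.

Lemma graph_iso_ex :
  (forall w v, linear (@Phi w v) /\ bijective (@Phi w v)) ->
  (forall w v x, bA x <-> bB (@Phi w v x)) ->
  exists theta : edge bA -> edge bB, graph_iso pi Phi theta.
Proof.
move=> PhiL PhiE.
exists (fun e => Edge ((PhiE _ _ _).1 (edge_mem e))); split => //.
- exact: iso_char_bij.
- apply: surj_inj_bij => [[w v x h] [w2 v2 x2 k] E|[w' v' y h]].
    (* The endpoints are identified first, so that the two edge vectors acquire the same type. *)
    have /(bij_inj (iso_char_bij pi)) ww := congr1 (@rng _ _ _) E.
    have /(bij_inj (iso_char_bij pi)) vv := congr1 (@src _ _ _) E.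
    rewrite /= in ww vv; subst w2 v2.
    have /(bij_inj (PhiL w v).2) xx := edge_vec_inj E.
    rewrite /= in xx; subst x2; congr Edge; exact: Prop_irrelevance.
  have [w ww] : exists w, iso_char pi w = w'.
    by exists (iso_char (triple_iso_inv pi) w'); rewrite iso_char_invK.
  have [v vv] : exists v, iso_char pi v = v'.
    by exists (iso_char (triple_iso_inv pi) v'); rewrite iso_char_invK.
  subst w' v'; have [g _ gK] := (PhiL w v).2.
  move: h; rewrite -(gK y) => h.
  exists (Edge ((PhiE _ _ _).2 h)).
  by rewrite /=; congr Edge; exact: Prop_irrelevance.
- by move=> e; exists ((PhiE _ _ _).1 (edge_mem e)).
Qed.

Variable theta : edge bA -> edge bB.
Hypothesis iso : graph_iso pi Phi theta.

Lemma graph_iso_bij : bijective theta. Proof. by case: iso. Qed.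

Lemma rng_theta e : rng (theta e) = iso_char pi (rng e).
Proof. by have [_ _ _ /(_ e)[h ->]] := iso. Qed.

Lemma src_theta e : src (theta e) = iso_char pi (src e).
Proof. by have [_ _ _ /(_ e)[h ->]] := iso. Qed.

(** The converse uses surjectivity of [theta]: the edge at [Phi x] is the image of some edge, whose
    endpoints and vector are [w], [v] and [x] by injectivity. *)
Lemma graph_iso_mem w v x : bA x <-> bB (@Phi w v x).
Proof.
have [PhiL _ [g gK gK'] thetaE] := iso; split=> [h|h].
  by have [] := thetaE (Edge h).
have := gK' (Edge h); case: (g (Edge h)) => w2 v2 x2 k.
have [/= k' ->] := thetaE (Edge k) => E.
have /(bij_inj (iso_char_bij pi)) ww := congr1 (@rng _ _ _) E.
have /(bij_inj (iso_char_bij pi)) vv := congr1 (@src _ _ _) E.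
rewrite /= in ww vv; subst w2 v2.
by have /(bij_inj (PhiL w v).2) <- := edge_vec_inj E.
Qed.

End EdgeBijection.

Section EdgeCoef.
Variables (R : realType) (A B : triple R) (pi : triple_iso A B).
Variables (bA : edge_family A) (bB : edge_family B).
Variable theta : edge bA -> edge bB.
Hypothesis bBfree : is_free_choice bB.
Hypothesis iso : graph_iso pi (iso_edge_space pi) theta.
Local Open Scope ring_scope.

(** By [graph_iso_mem], [bA] is the preimage of [bB] under the induced map; this and the
    compatibility of that map with q identify the coordinates. *)
Lemma edge_coef_theta e a : edge_coef (theta e) (pi a) = edge_coef e a.
Proof.
have memE := graph_iso_mem iso; have [_ _ _ /(_ e)[h ->]] := iso.
rewrite /edge_coef /= edge_quo_iso -(coord_preimage (@iso_edge_space_linear _ _ _ pi _ _)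
  (@iso_edge_spaceK _ _ _ pi _ _) (@iso_edge_space_invK _ _ _ pi _ _)) //; last first.
  by have [] := bBfree (iso_char pi (rng e)) (iso_char pi (src e)).
by congr (Defs.coord _ _ _); apply/seteqP; split=> x /memE.
Qed.

Lemma T3_mx_theta e f a : T3_mx (theta e) (theta f) (pi a) = T3_mx e f a.
Proof.
by rewrite /T3_mx !edge_coef_theta !(rng_theta iso) !(src_theta iso) !iso_char_funE.
Qed.

Lemma is_path_theta n (p : 'I_n.+1 -> edge bA) :
  is_path p <-> is_path (theta \o p).
Proof.
split=> pp i j ij.
  by rewrite /= (src_theta iso) (rng_theta iso) (pp i j).
apply: (bij_inj (iso_char_bij pi)).
by rewrite -(src_theta iso) -(rng_theta iso); exact: pp.
Qed.

Lemma admissible_theta n (p : 'I_n.+1 -> edge bA) :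
  admissible p <-> admissible (theta \o p).
Proof.
split=> -[pp [T [cT TE]]]; split; try exact/is_path_theta.
  exists (T \o iso_inv pi); split; first exact: cc_rep_iso.
  move=> b; have [T1 T2 T3] := TE (iso_inv pi b).
  rewrite -[b in tr_phi _ b](iso_invK pi); split=> [i||i] /=.
  - by rewrite (rng_theta iso) iso_char_funE.
  - by rewrite (src_theta iso) iso_char_funE.
  - by rewrite -[b in RHS](iso_invK pi) edge_coef_theta.
exists (T \o pi); split; first exact/(cc_rep_isoP (pi := pi)).
move=> a; have [T1 T2 T3] := TE (pi a); split=> [i||i] /=.
- by rewrite T1 /= (rng_theta iso) iso_char_funE.
- by rewrite T2 /= (src_theta iso) iso_char_funE.
- by rewrite T3 edge_coef_theta.
Qed.

End EdgeCoef.

(** * Topology and partitions *)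

Section CharacterTopology.
Variable R : realType.

Lemma continuous_ptws (X Y : topologicalType) (I : eqType) (f : X -> {ptws I -> Y}) :
  (forall i, continuous (fun x => f x i)) -> continuous f.
Proof.
move=> fc x; apply/cvg_sup => i.
exact: (@continuous_comp_initial _ _ _ (fun g : {ptws I -> Y} => g i) f (fc i)).
Qed.

Lemma character_eval_continuous (A : opalg R) (d : diag A) :
  continuous (fun v : character A => v d : R[i]^o).
Proof.
move=> v; pose ev := @char_fun R A : character A -> {ptws diag A -> R[i]^o}.
have evc : continuous ev by exact: initial_continuous.
exact: cvg_comp (evc v) (@proj_continuous (diag A) (fun=> R[i]^o) d (ev v)).
Qed.

Lemma iso_char_continuous (A B : triple R) (pi : triple_iso A B) :
  continuous (iso_char pi).
Proof.
apply: continuous_comp_initial; apply: continuous_ptws => d.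
exact: (@character_eval_continuous A (iso_inv_diag pi d)).
Qed.

Lemma iso_char_homeo (A B : triple R) (pi : triple_iso A B) :
  homeomorphism (iso_char pi).
Proof.
exists (iso_char (triple_iso_inv pi)); split.
- exact: iso_charK.
- exact: iso_char_invK.
- exact: iso_char_continuous.
- exact: iso_char_continuous.
Qed.

End CharacterTopology.

Section TopologicalGraphTransfer.
Variables (V E V' E' : topologicalType).
Variables (r s : E -> V) (r' s' : E' -> V') (h : E -> E') (chi : V -> V').
Hypotheses (hH : homeomorphism h) (chiH : homeomorphism chi).
Hypotheses (rE : forall x, r' (h x) = chi (r x)).
Hypotheses (sE : forall x, s' (h x) = chi (s x)).

Lemma topological_graph_homeo :
  topological_graph r s -> topological_graph r' s'.
Proof.
have [g [hK gK hc gc]] := hH; have [psi [chiK psiK chic psic]] := chiH.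
have r'E : r' = chi \o r \o g by apply/funext => y; rewrite /= -rE gK.
have s'E : s' = chi \o s \o g by apply/funext => y; rewrite /= -sE gK.
move=> [rc rp sl]; split.
- rewrite r'E => y; apply: continuous_comp; first exact: gc.
  by apply: continuous_comp; [exact: rc|exact: chic].
(* Written as a direct image, the preimage is compact by continuity of [psi] and [h] and properness
   of [r]. *)
- move=> K cK; have -> : r' @^-1` K = h @` (r @^-1` (psi @` K)).
    apply/seteqP; split=> y /=.
      by move=> Ky; exists (g y) => //; exists (r' y); rewrite // r'E /= chiK.
    by move=> [x [k Kk kx] <-]; rewrite rE -kx psiK.
  apply: continuous_compact; first exact: continuous_subspaceT.
  by apply: rp; apply: continuous_compact => //; exact: continuous_subspaceT.
- move=> y; have [U [oU Uy osU [t [tK sc tc]]]] := sl (g y).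
  have hU : h @` U = g @^-1` U.
    apply/seteqP; split=> [_ [x Ux <-]|z Uz] /=; first by rewrite hK.
    by exists (g z); rewrite ?gK.
  have s'U : s' @` (h @` U) = psi @^-1` (s @` U).
    apply/seteqP; split=> [_ [_ [x Ux <-] <-]|z [x Ux xz]] /=.
      by exists x; rewrite // sE chiK.
    by exists (h x); [exists x|rewrite sE xz psiK].
  have ohU : open (h @` U) by rewrite hU; exact: open_comp.
  have os'U : open (s' @` (h @` U)) by rewrite s'U; exact: open_comp.
  exists (h @` U); split=> //; first by rewrite hU.
  exists (h \o t \o psi); split.
  + move=> z /set_mem[x Ux <-]; rewrite /= sE chiK tK //; exact: mem_set.
  (* On an open set, continuity within the set is continuity at each of its points, which
     composes. *)
  + move: sc; rewrite !continuous_open_subspace // => sc z /set_mem.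
    rewrite hU => Ugz; rewrite s'E.
    apply: continuous_comp; first exact: gc.
    by apply: continuous_comp; [exact/sc/mem_set|exact: chic].
  + move: tc; rewrite !continuous_open_subspace // => tc z /set_mem.
    rewrite s'U => Uz.
    apply: continuous_comp; first exact: psic.
    by apply: continuous_comp; [exact/tc/mem_set|exact: hc].
Qed.

End TopologicalGraphTransfer.

Lemma image_injective (T U : Type) (f : T -> U) :
  injective f -> injective (fun X : set T => f @` X).
Proof.
move=> fI X Y XY; apply/seteqP; split=> x.
  by rewrite -(image_inj (A := X) fI) XY (image_inj fI).
by rewrite -(image_inj (A := Y) fI) -XY (image_inj fI).
Qed.

Lemma can_image (T U : Type) (f : T -> U) (g : U -> T) :
  cancel f g -> cancel (fun X : set T => f @` X) (fun Y : set U => g @` Y).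
Proof.
by move=> fK X; rewrite image_comp (_ : g \o f = idfun) ?image_id //; apply/funext.
Qed.

(** [part_rng] picks an edge by choice; distinct sources within a block leave a single candidate. *)
Lemma part_rngE (R : realType) (A : triple R) (b : edge_family A) (P : set (set (edge b)))
    (x : partition_edges P) (e : edge b) : distinct_sources P ->
  set_val (part_block x) e -> src e = part_src x -> part_rng x = rng e.
Proof.
move=> Pd xe ex; rewrite /part_rng; case: cid => f [xf fx] /=.
congr rng; apply: (Pd (set_val (part_block x))).
- exact: set_valP.
- exact: mem_set.
- exact: mem_set.
- by rewrite fx ex.
Qed.

(** The index factor is discrete, so any [beta] is continuous and the topological content lies in
    [psi]. *)
Lemma partition_edges_continuous (R : realType) (A1 A2 : triple R) (b1 : edge_family A1)
    (b2 : edge_family A2) (P : set (set (edge b1))) (Q : set (set (edge b2)))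
    (beta : set_type P -> set_type Q) (psi : character A1 -> character A2)
    (h : partition_edges P -> partition_edges Q) :
  continuous psi ->
  (forall x, set_val (h x) = (beta (part_block x), psi (part_src x))) ->
  continuous h.
Proof.
move=> psic hE; apply: continuous_comp_initial => x.
rewrite (_ : _ \o _ = fun x => (beta (part_block x), psi (part_src x))); last first.
  by apply/funext => y; exact: hE.
have valc : continuous (set_val : partition_edges P -> _) by exact: initial_continuous.
apply: (@cvg_pair _ _ _ (nbhs x)
  (nbhs (beta (part_block x) : discrete_topology (set_type Q)))
  (nbhs (psi (part_src x)))).
  pose beta' : discrete_topology (set_type P) -> discrete_topology (set_type Q) := beta.
  have betac : continuous beta' by apply/continuousP => U _; exact: discrete_open.
  exact: cvg_comp (cvg_comp _ _ (valc x) cvg_fst) (betac _).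
exact: cvg_comp (cvg_comp _ _ (valc x) cvg_snd) (psic _).
Qed.

(** * Images of partitions under a map of edges *)

Section PartMap.
Variables (R : realType) (A B : triple R).
Variables (bA : edge_family A) (bB : edge_family B) (theta : edge bA -> edge bB).

Lemma part_map_can (theta' : edge bB -> edge bA) :
  cancel theta theta' -> cancel (part_map theta) (part_map theta').
Proof. by move=> /can_image/can_image. Qed.

Lemma block_map_surj (P : set (set (edge bA))) (m : set_type (part_map theta P)) :
  exists l, block_map theta l = m.
Proof.
have [E PE Em] := set_mem (valP m); exists (SigSub (mem_set PE)).
exact: val_inj.
Qed.

Hypothesis thetaI : injective theta.

Lemma block_map_inj (P : set (set (edge bA))) : injective (block_map theta (P := P)).
Proof.
by move=> l m /(congr1 set_val) /(image_injective thetaI) /val_inj.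
Qed.

Lemma block_map_bij (P : set (set (edge bA))) : bijective (block_map theta (P := P)).
Proof. exact: surj_inj_bij (@block_map_inj P) (@block_map_surj P). Qed.

Lemma is_partition_map (P : set (set (edge bA))) :
  (forall f, exists e, theta e = f) ->
  is_partition P -> is_partition (part_map theta P).
Proof.
move=> thetaS [P0 PI PT]; split.
- by move=> _ [E /P0[e Ee] <-]; exists (theta e); exists e.
- move=> _ _ [E PE <-] [F PF <-] [_ [[e Ee <-] [f Ff /thetaI fe]]].
  by congr image; apply: PI => //; exists e; split; rewrite // -fe.
- apply/seteqP; split=> // f _; have [e <-] := thetaS f.
  have [E PE Ee] : (\bigcup_(E in P) E) e by rewrite PT.
  by exists (theta @` E); [exists E|exists e].
Qed.

Lemma part_equiv_map (P : set (set (edge bA))) e f :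
  part_equiv (part_map theta P) (theta e) (theta f) <-> part_equiv P e f.
Proof.
split=> [[_ [[E PE <-]]]|[E [PE Ee Ef]]].
  by rewrite !(image_inj thetaI) => Ee Ef; exists E.
by exists (theta @` E); split; [exists E|exists e|exists f].
Qed.

Lemma part_le_map (P Q : set (set (edge bA))) :
  part_le P Q <-> part_le (part_map theta P) (part_map theta Q).
Proof.
split=> PQ e f; last by rewrite -2!part_equiv_map; exact: PQ.
move=> [_ [[E QE <-] [e' Ee <-] [f' Ef <-]]].
by apply/part_equiv_map/PQ; exists E.
Qed.

Variable chi : character A -> character B.
Hypothesis srcE : forall e, src (theta e) = chi (src e).
Hypothesis rngE : forall e, rng (theta e) = chi (rng e).
Hypothesis chiH : homeomorphism chi.

Lemma distinct_sources_map (P : set (set (edge bA))) :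
  distinct_sources P -> distinct_sources (part_map theta P).
Proof.
have [psi [chiK _ _ _]] := chiH.
move=> Pd _ [E PE <-] _ _ /set_mem[e Ee <-] /set_mem[f Ef <-].
rewrite !srcE => /(can_inj chiK) ef; congr theta.
by apply: (Pd E) => //; exact: mem_set.
Qed.

Lemma partition_edges_homeo (P : set (set (edge bA))) :
  exists h : partition_edges P -> partition_edges (part_map theta P),
    homeomorphism h /\
    forall x, part_block (h x) = block_map theta (part_block x) /\
              part_src (h x) = chi (part_src x).
Proof.
have [psi [chiK psiK chic psic]] := chiH.
have [beta betaK betaK'] := block_map_bij P.
have hP (x : partition_edges P) :
    partition_edges (part_map theta P) (block_map theta (part_block x), chi (part_src x)).
  have [e [xe ex]] := part_edge_subproof x.
  by exists (theta e); split; [exists e|rewrite srcE ex].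
have gP (y : partition_edges (part_map theta P)) :
    partition_edges P (beta (part_block y), psi (part_src y)).
  have [f []] := part_edge_subproof y.
  rewrite -{1}(betaK' (part_block y)) => -[e ye <-].
  by rewrite srcE => <-; exists e; rewrite chiK.
pose h x : partition_edges (part_map theta P) := SigSub (mem_set (hP x)).
pose g y : partition_edges P := SigSub (mem_set (gP y)).
exists h; split => //; exists g; split.
- move=> x; apply: val_inj; rewrite /= betaK chiK; exact/esym/surjective_pairing.
- move=> y; apply: val_inj; rewrite /= betaK' psiK; exact/esym/surjective_pairing.
- exact: (partition_edges_continuous (beta := block_map theta (P := P)) chic).
- exact: (partition_edges_continuous (beta := beta) psic).
Qed.

Lemma part_rng_map (P : set (set (edge bA))) (x : partition_edges P)
    (y : partition_edges (part_map theta P)) : distinct_sources P ->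
  part_block y = block_map theta (part_block x) -> part_src y = chi (part_src x) ->
  part_rng y = chi (part_rng x).
Proof.
move=> Pd byx syx; have [e [xe ex]] := part_edge_subproof x.
rewrite (part_rngE Pd xe ex) -rngE; apply: part_rngE.
- exact: distinct_sources_map.
- by rewrite byx; exists e.
- by rewrite srcE syx ex.
Qed.

Lemma topological_partition_map (P : set (set (edge bA))) :
  (forall f, exists e, theta e = f) ->
  topological_partition P -> topological_partition (part_map theta P).
Proof.
move=> thetaS [Pp Pd Pt]; split.
- exact: is_partition_map.
- exact: distinct_sources_map.
have [h [hH hE]] := partition_edges_homeo P.
apply: topological_graph_homeo hH chiH _ _ Pt => x.
  by have [] := hE x; exact: part_rng_map.
by have [] := hE x.
Qed.

End PartMap.

(** * Transport of colorings and of colored graphs *)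

Section ColorMap.
Variables (R : realType) (A B : triple R).
Variables (bA : edge_family A) (bB : edge_family B) (theta : edge bA -> edge bB).

(** Choosing a preimage block makes sense before [theta] is known to be injective; injectivity
    enters in [color_mapE], which characterizes the map. *)
Definition color_map (P : set (set (edge bA))) (f : set_type P -> nat)
    (m : set_type (part_map theta P)) : nat :=
  f (sval (cid (block_map_surj m))).

Hypothesis thetaI : injective theta.

Lemma color_mapE (P : set (set (edge bA))) (f : set_type P -> nat) l :
  color_map f (block_map theta l) = f l.
Proof. by rewrite /color_map; congr f; case: cid => m /= /(block_map_inj thetaI). Qed.

Lemma color_map_inj (P : set (set (edge bA))) : injective (@color_map P).
Proof.
by move=> f g fg; apply/funext => l; rewrite -color_mapE fg color_mapE.
Qed.

Lemma color_map_surj (P : set (set (edge bA))) (g : set_type (part_map theta P) -> nat) :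
  exists f, color_map f = g.
Proof.
exists (g \o block_map theta (P := P)); apply/funext => m.
by have [l <-] := block_map_surj m; rewrite color_mapE.
Qed.

(** The permutations witnessing the two orders are conjugate under [block_map]. *)
Lemma coloring_le_map (P : set (set (edge bA))) (f g : set_type P -> nat) :
  coloring_le f g <-> coloring_le (color_map f) (color_map g).
Proof.
have [beta betaK betaK'] := block_map_bij thetaI P.
split=> -[s [sB fg]].
  exists (block_map theta (P := P) \o s \o beta); split.
    apply: bij_comp; last by exists (block_map theta (P := P)).
    by apply: bij_comp => //; exists beta.
  by move=> m; have [l <-] := block_map_surj m; rewrite /= betaK !color_mapE.
exists (beta \o s \o block_map theta (P := P)); split.
  apply: bij_comp; last by exists beta.
  by apply: bij_comp => //; exists (block_map theta (P := P)).
by move=> l; rewrite -(color_mapE f) -(color_mapE g) /= betaK'.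
Qed.

Hypothesis rngE : forall e f, (rng (theta e) = rng (theta f)) <-> (rng e = rng f).
Hypothesis T3E : forall e f, cc_rep (T3_mx (theta e) (theta f)) <-> cc_rep (T3_mx e f).

Lemma coloring_map (P : set (set (edge bA))) (f : set_type P -> nat) :
  coloring P f <-> coloring (part_map theta P) (color_map f).
Proof.
split=> fP l m lm; last first.
  move=> [e1 [e2 [le1 me2 /rngE r12 /T3E T12]]].
  rewrite -(color_mapE f l) -(color_mapE f m); apply: fP.
    by move=> /(block_map_inj thetaI).
  by exists (theta e1), (theta e2); split => //; [exists e1|exists e2].
have [k kl] := block_map_surj l; have [n nm] := block_map_surj m; subst l m.
move=> [_ [_ [[e1 ke1 <-] [e2 ne2 <-] /rngE r12 /T3E T12]]].
rewrite !color_mapE; apply: fP; first by move=> kn; apply: lm; rewrite kn.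
by exists e1, e2.
Qed.

Definition colored_map (X : colored_partition bA) : colored_partition bB :=
  existT _ (part_map theta (projT1 X)) (color_map (projT2 X)).

Lemma colored_map_inj : injective colored_map.
Proof.
move=> [P f] [Q g] XY.
have PQ : P = Q := image_injective (image_injective thetaI) (congr1 (@projT1 _ _) XY).
subst Q; congr existT; apply: color_map_inj.
move: XY; apply: Eqdep_dec.inj_pair2_eq_dec; exact: eq_comparable.
Qed.

End ColorMap.

Section GraphIsoConsequences.
Variables (R : realType) (A B : triple R) (pi : triple_iso A B).
Variables (bA : edge_family A) (bB : edge_family B).
Variable Phi : forall w v : character A,
  edge_space w v -> edge_space (iso_char pi w) (iso_char pi v).
Variable theta : edge bA -> edge bB.
Hypothesis iso : graph_iso pi Phi theta.

Let thetaI : injective theta := bij_inj (graph_iso_bij iso).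

Let theta_surj f : exists e, theta e = f.
Proof. by have [g _ gK] := graph_iso_bij iso; exists (g f). Qed.

Let topo_map := topological_partition_map thetaI (src_theta iso) (rng_theta iso)
  (iso_char_homeo pi).

(** [topological_partition_map] asks for a map of edges over a homeomorphism of vertices, with no
    edge spaces involved, so it applies to the inverse of [theta] as well. *)
Lemma topological_partition_surj (Q : set (set (edge bB))) : topological_partition Q ->
  exists2 P, topological_partition P & part_map theta P = Q.
Proof.
move=> tQ; have [theta' K K'] := graph_iso_bij iso.
exists (part_map theta' Q); last exact: (part_map_can K').
apply: (@topological_partition_map _ _ _ _ _ theta' (can_inj K')
          (iso_char (triple_iso_inv pi))) tQ.
- by move=> e; rewrite -{2}(K' e) (src_theta iso) iso_charK.
- by move=> e; rewrite -{2}(K' e) (rng_theta iso) iso_charK.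
- exact: iso_char_homeo.
- by move=> e; exists (theta e).
Qed.

Lemma topological_partition_set_bij :
  set_bij (@topological_partition R A bA) (@topological_partition R B bB)
    (part_map theta).
Proof.
split=> [P|P Q _ _|Q /topological_partition_surj[P]]; last by exists P.
- exact: topo_map.
- exact: (image_injective (image_injective thetaI)).
Qed.

Lemma part_map_countable (P : set (set (edge bA))) :
  countable P <-> countable (part_map theta P).
Proof.
split; first exact/card_le_trans/card_image_le.
have [theta' K _] := graph_iso_bij iso.
by rewrite -{2}(part_map_can K P); exact/card_le_trans/card_image_le.
Qed.

Lemma colored_map_iso (X : colored_partition bA) : colored_graphs X ->
  colored_graph_iso pi theta X (colored_map theta X).
Proof.
move=> [[_ Pd _] _ _]; split=> //; split; first exact: iso_char_homeo.
have [h [hH hE]] :=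
  partition_edges_homeo thetaI (src_theta iso) (iso_char_homeo pi) (projT1 X).
exists h; split=> // x; have [bx sx] := hE x; split.
- exact: sx.
- exact: (part_rng_map (src_theta iso) (rng_theta iso) (iso_char_homeo pi) Pd bx sx).
- by rewrite bx.
- by rewrite bx /= color_mapE.
Qed.

End GraphIsoConsequences.

Section FreeConsequences.
Variables (R : realType) (A B : triple R) (pi : triple_iso A B).
Variables (bA : edge_family A) (bB : edge_family B).
Variable theta : edge bA -> edge bB.
Hypothesis bBfree : is_free_choice bB.
Hypothesis iso : graph_iso pi (iso_edge_space pi) theta.

Let thetaI : injective theta := bij_inj (graph_iso_bij iso).

Let rng_eq e f : rng (theta e) = rng (theta f) <-> rng e = rng f.
Proof.
rewrite !(rng_theta iso); split=> [|->//].
exact: (bij_inj (iso_char_bij pi)).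
Qed.

Let T3_cc e f : cc_rep (T3_mx (theta e) (theta f)) <-> cc_rep (T3_mx e f).
Proof.
apply: iff_sym; apply: (@cc_rep_isoP _ _ _ pi) => a.
exact: T3_mx_theta bBfree iso e f a.
Qed.

Lemma coloring_theta (P : set (set (edge bA))) (f : set_type P -> nat) :
  coloring P f <-> coloring (part_map theta P) (color_map f).
Proof. exact: coloring_map. Qed.

Lemma coloring_set_bij (P : set (set (edge bA))) :
  set_bij (coloring P) (coloring (part_map theta P)) (@color_map _ _ _ _ _ theta P).
Proof.
split=> [f /coloring_theta//|f g _ _ /(color_map_inj thetaI)//|g gP].
have [f fg] := color_map_surj thetaI g; exists f => //.
by apply/coloring_theta; rewrite fg.
Qed.

Lemma colored_graphs_set_bij :
  set_bij (@colored_graphs R A bA) (@colored_graphs R B bB) (colored_map theta).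
Proof.
split=> [X [tX cX /coloring_theta fX]|X Y _ _ /(colored_map_inj thetaI)//|].
  split=> //=; last exact/(part_map_countable iso).
  by case: (topological_partition_set_bij iso) => + _ _; apply.
move=> [Q g] [/= tQ cQ gQ].
have [P tP PQ] := topological_partition_surj iso tQ; subst Q.
have [f fg] := color_map_surj thetaI g; subst g.
exists (existT _ P f) => //; split=> //=; first exact/(part_map_countable iso).
exact/coloring_theta.
Qed.

End FreeConsequences.

(** * Pulling back free choices of bases *)

Section FreeChoices.
Variables (R : realType) (A B : triple R) (pi : triple_iso A B).
Local Notation pi' := (triple_iso_inv pi).

Lemma edge_free_iso : edge_free B -> edge_free A.
Proof.
move=> Bfree v w; have [c cB] := Bfree (iso_char pi v) (iso_char pi w).
by exists (@iso_edge_space _ _ _ pi w v @^-1` c); exact: free_basis_preimage.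
Qed.

Definition edge_family_preimage (bB : edge_family B) : edge_family A :=
  fun w v => @iso_edge_space _ _ _ pi w v @^-1` bB (iso_char pi w) (iso_char pi v).

Lemma free_choice_preimage (bB : edge_family B) :
  is_free_choice bB -> is_free_choice (edge_family_preimage bB).
Proof. by move=> bBfree w v; exact: free_basis_preimage. Qed.

Lemma iso_edge_space_bij w v :
  linear (@iso_edge_space _ _ _ pi w v) /\ bijective (@iso_edge_space _ _ _ pi w v).
Proof.
split; first exact: iso_edge_space_linear.
exists (@iso_edge_space_inv _ _ _ pi w v).
- exact: iso_edge_spaceK.
- exact: iso_edge_space_invK.
Qed.

End FreeChoices.

(* The composite of the two maps of edge spaces is the identity only up to the
   identification of [iso_char pi' (iso_char pi v)] with [v]. *)
Lemma edge_family_preimage_inv (R : realType) (A B : triple R) (pi : triple_iso A B)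
    (bA : edge_family A) (w v : character A) (x : edge_space w v) :
  edge_family_preimage (triple_iso_inv pi) bA (iso_edge_space pi x) <-> bA w v x.
Proof.
have kerK k : iso_ker (triple_iso_inv pi) (iso_ker pi k) = k.
  by apply: val_inj; rewrite /= iso_funK.
rewrite /edge_family_preimage /preimage /= {2}/iso_edge_space iso_edge_space_pi kerK.
rewrite -[in X in _ <-> X](reprK x); move: (repr x) => k {x}.
(* With the twice transported characters generalized to variables, [subst] can identify them with
   [w] and [v] inside the types. *)
move: (iso_char (triple_iso_inv pi) (iso_char pi w)) (iso_charK pi w) => w2 ww.
move: (iso_char (triple_iso_inv pi) (iso_char pi v)) (iso_charK pi v) => v2 vv.
by subst w2 v2.
Qed.

Theorem theorem1 (R : realType) (A B : triple R) (pi : triple_iso A B) :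
  (* (1) the graph G(A), for arbitrary choices of the bases *)
  (forall (bA : edge_family A) (bB : edge_family B),
     is_basis_choice bA -> is_basis_choice bB ->
     exists (Phi : forall w v : character A,
                     edge_space w v -> edge_space (iso_char pi w) (iso_char pi v))
            (theta : edge bA -> edge bB),
       graph_iso pi Phi theta)
  /\
  (* (2) edge freeness; moreover the choices of bases witnessing it correspond
     under the maps of edge spaces induced by pi *)
  ((edge_free A <-> edge_free B) /\
   (forall bA : edge_family A, is_free_choice bA ->
      exists (bB : edge_family B) (theta : edge bA -> edge bB),
        is_free_choice bB /\ graph_iso pi (iso_edge_space pi) theta) /\
   (forall bB : edge_family B, is_free_choice bB ->
      exists (bA : edge_family A) (theta : edge bA -> edge bB),
        is_free_choice bA /\ graph_iso pi (iso_edge_space pi) theta))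
  /\
  (* (3) admissible paths *)
  (edge_free A ->
   forall (bA : edge_family A) (bB : edge_family B) (theta : edge bA -> edge bB),
     is_free_choice bA -> is_free_choice bB ->
     graph_iso pi (iso_edge_space pi) theta ->
     forall (n : nat) (p : 'I_n.+1 -> edge bA),
       (is_path p <-> is_path (theta \o p)) /\
       (admissible p <-> admissible (theta \o p)))
  /\
  (* (4) the weak-* topology *)
  homeomorphism (iso_char pi)
  /\
  (* (5) the partially ordered set of topological partitions *)
  (forall (bA : edge_family A) (bB : edge_family B)
      (Phi : forall w v : character A,
               edge_space w v -> edge_space (iso_char pi w) (iso_char pi v))
      (theta : edge bA -> edge bB),
     is_basis_choice bA -> is_basis_choice bB -> graph_iso pi Phi theta ->
     set_bij (@topological_partition R A bA) (@topological_partition R B bB)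
             (part_map theta) /\
     forall P Q, topological_partition P -> topological_partition Q ->
       (part_le P Q <-> part_le (part_map theta P) (part_map theta Q)))
  /\
  (* (6) the partially ordered set of coloring functions *)
  (edge_free A ->
   forall (bA : edge_family A) (bB : edge_family B) (theta : edge bA -> edge bB),
     is_free_choice bA -> is_free_choice bB ->
     graph_iso pi (iso_edge_space pi) theta ->
     forall P : set (set (edge bA)),
       topological_partition P -> countable P ->
       exists F : (set_type P -> nat) -> (set_type (part_map theta P) -> nat),
         (forall f l, F f (block_map theta l) = f l) /\
         set_bij (coloring P) (coloring (part_map theta P)) F /\
         forall f g, coloring P f -> coloring P g ->
           (coloring_le f g <-> coloring_le (F f) (F g)))
  /\
  (* (7) the collection of compatible edge-colored topological graphs *)
  (edge_free A ->
   forall (bA : edge_family A) (bB : edge_family B) (theta : edge bA -> edge bB),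
     is_free_choice bA -> is_free_choice bB ->
     graph_iso pi (iso_edge_space pi) theta ->
     exists Psi : colored_partition bA -> colored_partition bB,
       set_bij (@colored_graphs R A bA) (@colored_graphs R B bB) Psi /\
       forall X, colored_graphs X -> colored_graph_iso pi theta X (Psi X)).
Proof.
split; [|split; [|split; [|split; [|split; [|split]]]]].
- move=> bA bB bAB bBB.
  have PhiP (p : character A * character A) : exists F : edge_space p.1 p.2 ->
      edge_space (iso_char pi p.1) (iso_char pi p.2),
      [/\ linear F, bijective F & forall x, bA p.1 p.2 x <-> bB _ _ (F x)].
    exact: (hamel_basis_iso (@iso_edge_space_linear _ _ _ pi _ _)
      (@iso_edge_spaceK _ _ _ pi _ _) (@iso_edge_space_invK _ _ _ pi _ _)).
  pose Phi w v := sval (cid (PhiP (w, v))).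
  exists Phi; apply: graph_iso_ex => w v.
    by rewrite /Phi; case: cid => F [].
  by rewrite /Phi; case: cid => F [].
- split; [split; [exact: edge_free_iso (triple_iso_inv pi)|exact: edge_free_iso]|split].
  (* Bases are pushed forward to [B] by pulling them back along the inverse isomorphism. *)
  + move=> bA bAfree; exists (edge_family_preimage (triple_iso_inv pi) bA).
    have [theta iso] := graph_iso_ex (iso_edge_space_bij pi)
      (fun w v x => iff_sym (edge_family_preimage_inv pi bA x)).
    by exists theta; split=> //; exact: free_choice_preimage.
  + move=> bB bBfree; exists (edge_family_preimage pi bB).
    have [//|theta iso] := graph_iso_ex (bA := edge_family_preimage pi bB) (bB := bB)
      (iso_edge_space_bij pi).
    by exists theta; split=> //; exact: free_choice_preimage.
- move=> _ bA bB theta _ bBfree iso n p; split; first exact: is_path_theta iso _ _.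
  exact: admissible_theta bBfree iso _ _.
- exact: iso_char_homeo.
- move=> bA bB Phi theta _ _ iso; split; first exact: topological_partition_set_bij iso.
  by move=> P Q _ _; apply: part_le_map; exact: bij_inj (graph_iso_bij iso).
- move=> _ bA bB theta _ bBfree iso P _ _; exists (@color_map _ _ _ _ _ theta P).
  have thetaI := bij_inj (graph_iso_bij iso).
  split; [|split; [exact: coloring_set_bij bBfree iso _|]].
    by move=> f l; exact: color_mapE.
  by move=> f g _ _; exact: coloring_le_map.
- move=> _ bA bB theta _ bBfree iso; exists (colored_map theta).
  split; first exact: colored_graphs_set_bij bBfree iso.
  exact: colored_map_iso iso.
Qed.
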